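(* Let $V$ be a strongly $A$-graded Möbius vertex algebra, $W_1,W_2$ strongly $\tilde A$-graded generalized $V$-modules and $z\in\mathbb C^\times$. Then the subspace $\mathrm{COMP}_{P(z)}((W_1\otimes W_2)^* )$ of $(W_1\otimes W_2)^*$ consisting of the elements satisfying the $P(z)$-compatibility condition is stable under the operators $\tau_{P(z)}(v\otimes t^n)$ ($v\in V$, $n\in\mathbb Z$) and under $L'_{P(z)}(-1)$, $L'_{P(z)}(0)$, $L'_{P(z)}(1)$. The same holds for the subspace $\mathrm{LGR}_{[\mathbb C];P(z)}((W_1\otimes W_2)^* )$ of elements satisfying the $P(z)$-local grading restriction condition, and for the subspace $\mathrm{LGR}_{(\mathbb C);P(z)}((W_1\otimes W_2)^* )$ of elements satisfying the $L(0)$-semisimple $P(z)$-local grading restriction condition.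
   Context: Formal calculus: $x,x_0,x_1$ commuting independent formal variables; $\delta(x)=\sum_{n\in\mathbb Z}x^n$; binomial expansions in nonnegative integral powers of the second summand; $\mathrm{Res}_x$ takes the coefficient of $x^{-1}$. Möbius vertex algebras, generalized modules $W=\coprod_{n\in\mathbb C}W_{[n]}$ with $\mathfrak{sl}(2)$-actions $L(-1),L(0),L(1)$, and strong gradedness (second gradings by abelian groups $A\subset\tilde A$ compatible with weight gradings, finite-dimensional doubly homogeneous spaces, appropriate truncation from below, $v_lW^{(\beta)}\subset W^{(\alpha+\beta)}$ for $v\in V^{(\alpha)}$, $L(j)$ grading-preserving) are as usual. Opposite operators: $Y^o_W(v,x)=Y_W(e^{xL(1)}(-x^{-2})^{L(0)}v,x^{-1})$. For $\lambda\in(W_1\otimes W_2)^*$: $(Y'_{P(z)}(v,x)\lambda)(w_{(1)}\otimes w_{(2)})=\lambda(w_{(1)}\otimes Y_2^o(v,x)w_{(2)})+\mathrm{Res}_{x_0}z^{-1}\delta(\frac{x^{-1}-x_0}{z})\lambda(Y_1(e^{xL(1)}(-x^{-2})^{L(0)}v,x_0)w_{(1)}\otimes w_{(2)})$, and $\tau_{P(z)}(v\otimes t^n)\lambda$ is the coefficient of $x^{-n-1}$ in $Y'_{P(z)}(v,x)\lambda$; $(L'_{P(z)}(j)\lambda)(w_{(1)}\otimes w_{(2)})=\lambda\big(w_{(1)}\otimes L(-j)w_{(2)}+\sum_{i=0}^{1-j}\binom{1-j}iz^iL(-j-i)w_{(1)}\otimes w_{(2)}\big)$ for $j=0,\pm1$.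 $P(z)$-compatibility condition on $\lambda$: (a) for every $v$, $Y'_{P(z)}(v,x)\lambda$ involves only finitely many negative powers of $x$; (b) for all $v,w_{(1)},w_{(2)}$: $x_0^{-1}\delta(\frac{x_1^{-1}-z}{x_0})(Y'_{P(z)}(v,x_1)\lambda)(w_{(1)}\otimes w_{(2)})=z^{-1}\delta(\frac{x_1^{-1}-x_0}{z})\lambda(Y_1(e^{x_1L(1)}(-x_1^{-2})^{L(0)}v,x_0)w_{(1)}\otimes w_{(2)})+x_0^{-1}\delta(\frac{z-x_1^{-1}}{-x_0})\lambda(w_{(1)}\otimes Y_2^o(v,x_1)w_{(2)})$. Gradings on $(W_1\otimes W_2)^*$: $((W_1\otimes W_2)^* )^{(\beta)}$ is the set of $\lambda$ vanishing on $W_1^{(\gamma_1)}\otimes W_2^{(\gamma_2)}$ whenever $\gamma_1+\gamma_2\ne-\beta$; $((W_1\otimes W_2)^* )^{(\beta)}_{[n]}$ (resp. $_{(n)}$) is its generalized (resp. ordinary) eigenspace for $L'_{P(z)}(0)$ with eigenvalue $n$. $P(z)$-local grading restriction condition on $\lambda$: (a) $\lambda\in\coprod_{n\in\mathbb C,\beta\in\tilde A}((W_1\otimes W_2)^* )^{(\beta)}_{[n]}$; (b) letting $W_\lambda$ be the smallest $\tilde A$-graded subspace of that space containing $\lambda$ and stable under all $\tau_{P(z)}(v\otimes t^m)$ and $L'_{P(z)}(j)$, $j=0,\pm1$, one has $\dim(W_\lambda)^{(\beta)}_{[n]}<\infty$ and $(W_\lambda)^{(\beta)}_{[n+k]}=0$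 for $k\in\mathbb Z$ sufficiently negative, for all $n\in\mathbb C$, $\beta\in\tilde A$ (where $(W_\lambda)^{(\beta)}_{[n]}=W_\lambda\cap((W_1\otimes W_2)^* )^{(\beta)}_{[n]}$). The $L(0)$-semisimple version is the same with generalized eigenspaces $[n]$ replaced by ordinary eigenspaces $(n)$ throughout. *)

(* Defs.v *)
From Stdlib Require Import ClassicalEpsilon.
From mathcomp Require Import all_boot all_algebra.
From mathcomp Require Import complex Rstruct.
Set Implicit Arguments. Unset Strict Implicit. Unset Printing Implicit Defensive.
Import GRing.Theory Num.Theory.
Local Open Scope ring_scope.

Definition C : numClosedFieldType := (Rdefinitions.R)[i]%C.

(* Formal calculus: coefficients of products of formal series are     *)
(* (finite) sums; fsumZ / fsumN sum a finitely supported family        *)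
(* (over int, resp. nat).  All sums used below are finitely supported  *)
(* whenever the corresponding formal expression is defined.            *)
Section FSum.
Variable M : zmodType.
Definition fsuppZ (f : int -> M) (N : nat) :=
  forall n : int, (N%:Z < `|n|)%R -> f n = 0.
Definition fsumZ (f : int -> M) : M :=
  let N := epsilon (inhabits 0%N) (fsuppZ f) in
  \sum_(i < (N + N).+1) f (i%:Z - N%:Z).
Definition fsuppN (f : nat -> M) (N : nat) := forall n : nat, (N <= n)%N -> f n = 0.
Definition fsumN (f : nat -> M) : M :=
  let N := epsilon (inhabits 0%N) (fsuppN f) in \sum_(i < N) f i.
End FSum.

Definition binz (r : int) (i : nat) : C :=
  (\prod_(j < i) (r%:~R - j%:R)) / (i`!)%:R.

Definition minus1to1 : seq int := [:: -1; 0; 1].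

Section LinAlg.
Variable M : lmodType C.
Definition subspace (P : M -> Prop) :=
  P 0 /\ forall (a : C) x y, P x -> P y -> P (a *: x + y).
Definition dsum (I : eqType) (F : I -> M -> Prop) :=
  (forall i, subspace (F i)) /\
  (forall v, exists (s : seq I) (c : I -> M),
      (forall i, F i (c i)) /\ v = \sum_(i <- s) c i) /\
  (forall (s : seq I) (c : I -> M), uniq s -> (forall i, F i (c i)) ->
      \sum_(i <- s) c i = 0 -> forall i, i \in s -> c i = 0).
Definition findim (P : M -> Prop) :=
  exists s : seq M, forall v, P v ->
    exists c : nat -> C, v = \sum_(i < size s) c i *: s`_i.
Definition gspan (I J : eqType) (F : I -> J -> M -> Prop) (g : J) (v : M) :=
  exists (s : seq I) (c : I -> M), (forall n, F n g (c n)) /\ v = \sum_(n <- s) c n.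
End LinAlg.

(* vaY u n w = u_n w  (Y(u,x) = sum_n u_n x^{-n-1});                   *)
(* vaL j = L(j), j = -1,0,1;  vaG n a = V^{(a)}_{(n)}.                 *)
(* The Jacobi identity is stated coefficientwise (coefficient of       *)
(* x0^{-r-1} x1^{-p-1} x2^{-q-1}), i.e. as the Borcherds identity.      *)
Record SGMobiusVA (A : zmodType) := {
  vaV :> lmodType C;
  vac : vaV;
  vaY : vaV -> int -> vaV -> vaV;
  vaL : int -> vaV -> vaV;
  vaG : int -> A -> vaV -> Prop;
  va_Ylin1 : forall n w (a : C) u1 u2,
      vaY (a *: u1 + u2) n w = a *: vaY u1 n w + vaY u2 n w;
  va_Ylin2 : forall u n (a : C) w1 w2,
      vaY u n (a *: w1 + w2) = a *: vaY u n w1 + vaY u n w2;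
  va_trunc : forall u w, exists N : int, forall n, N < n -> vaY u n w = 0;
  va_vacuum : forall n w, vaY vac n w = if n == -1 then w else 0;
  va_creation : forall u n, 0 <= n -> vaY u n vac = 0;
  va_creation1 : forall u, vaY u (-1) vac = u;
  va_jacobi : forall u v w (p q r : int),
      fsumN (fun i => binz p i *: vaY (vaY u (r + i%:Z) v) (p + q - i%:Z) w) =
      fsumN (fun i => ((-1) ^+ i * binz r i) *:
          (vaY u (r + p - i%:Z) (vaY v (q + i%:Z) w)
           - (-1) ^ r *: vaY v (r + q - i%:Z) (vaY u (p + i%:Z) w)));
  va_Llin : forall j (a : C) u v, vaL j (a *: u + v) = a *: vaL j u + vaL j v;
  va_sl2 : forall j k, j \in minus1to1 -> k \in minus1to1 -> (j + k) \in minus1to1 ->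
      forall v, vaL j (vaL k v) - vaL k (vaL j v) = (j - k)%:~R *: vaL (j + k) v;
  va_L0 : forall n a v, vaG n a v -> vaL 0 v = n%:~R *: v;
  va_Lder : forall v n w, vaY (vaL (-1) v) n w = - n%:~R *: vaY v (n - 1) w;
  va_Lcomm : forall j, j \in minus1to1 -> forall v n w,
      vaL j (vaY v n w) - vaY v n (vaL j w) =
      \sum_(k < (absz (j + 1)).+1)
         ('C((absz (j + 1)), k))%:R *: vaY (vaL (j - k%:Z) v) (n + k%:Z) w;
  va_dsum : dsum (fun i : int * A => vaG i.1 i.2);
  va_findim : forall n a, findim (vaG n a);
  va_lowtrunc : forall a, exists N : int, forall n, n < N -> forall v, vaG n a v -> v = 0;
  va_vacG : vaG 0 0 vac;
  va_YG : forall a b u v l, gspan vaG a u -> gspan vaG b v -> gspan vaG (a + b) (vaY u l v);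
  va_LG : forall j a v, j \in minus1to1 -> gspan vaG a v -> gspan vaG a (vaL j v)
}.

Record SGGenModule (A At : zmodType) (iota : A -> At) (V : SGMobiusVA A) := {
  mW :> lmodType C;
  mY : V -> int -> mW -> mW;
  mL : int -> mW -> mW;
  mG : C -> At -> mW -> Prop;
  m_Ylin1 : forall n w (a : C) (u1 u2 : V),
      mY (a *: u1 + u2) n w = a *: mY u1 n w + mY u2 n w;
  m_Ylin2 : forall u n (a : C) w1 w2,
      mY u n (a *: w1 + w2) = a *: mY u n w1 + mY u n w2;
  m_trunc : forall u w, exists N : int, forall n, N < n -> mY u n w = 0;
  m_vacuum : forall n w, mY (@vac _ V) n w = if n == -1 then w else 0;
  m_jacobi : forall (u v : V) w (p q r : int),
      fsumN (fun i => binz p i *: mY (vaY u (r + i%:Z) v) (p + q - i%:Z) w) =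
      fsumN (fun i => ((-1) ^+ i * binz r i) *:
          (mY u (r + p - i%:Z) (mY v (q + i%:Z) w)
           - (-1) ^ r *: mY v (r + q - i%:Z) (mY u (p + i%:Z) w)));
  m_Llin : forall j (a : C) u v, mL j (a *: u + v) = a *: mL j u + mL j v;
  m_sl2 : forall j k, j \in minus1to1 -> k \in minus1to1 -> (j + k) \in minus1to1 ->
      forall w, mL j (mL k w) - mL k (mL j w) = (j - k)%:~R *: mL (j + k) w;
  m_L0 : forall n b w, mG n b w -> exists k : nat, iter k (fun x => mL 0 x - n *: x) w = 0;
  m_Lder : forall v n w, mY (@vaL _ V (-1) v) n w = - n%:~R *: mY v (n - 1) w;
  m_Lcomm : forall j, j \in minus1to1 -> forall v n w,
      mL j (mY v n w) - mY v n (mL j w) =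
      \sum_(k < (absz (j + 1)).+1)
         ('C((absz (j + 1)), k))%:R *: mY (@vaL _ V (j - k%:Z) v) (n + k%:Z) w;
  m_dsum : dsum (fun i : C * At => mG i.1 i.2);
  m_findim : forall n b, findim (mG n b);
  m_lowtrunc : forall n b, exists K : int, forall k : int, k < K ->
      forall w, mG (n + k%:~R) b w -> w = 0;
  m_YG : forall a b v w l, gspan (@vaG _ V) a v -> gspan mG b w ->
      gspan mG (iota a + b) (mY v l w);
  m_LG : forall j b w, j \in minus1to1 -> gspan mG b w -> gspan mG b (mL j w)
}.

(* The dual space (W1 (x) W2)^*, represented as bilinear forms.        *)
Section Dual.
Variables (A At : zmodType) (iota : A -> At) (V : SGMobiusVA A).
Variables (W1 W2 : SGGenModule iota V) (z : C).

Local Notation X := (W1 -> W2 -> C).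

Definition bilinearX (l : X) :=
  (forall w2 (a : C) x y, l (a *: x + y) w2 = a * l x w2 + l y w2) /\
  (forall w1 (a : C) x y, l w1 (a *: x + y) = a * l w1 x + l w1 y).

Definition wtcomp (v : V) : int -> V :=
  epsilon (inhabits (fun _ : int => (0 : V)))
    (fun c => (exists N, fsuppZ c N) /\
       (forall m, @vaL _ V 0 (c m) = m%:~R *: c m) /\ v = fsumZ c).

(* coefficient of x^p in  e^{x L(1)} (-x^{-2})^{L(0)} v :
   sum over m, j with j - 2m = p of (-1)^m/j! L(1)^j v_(m) *)
Definition oppvec (v : V) (p : int) : V :=
  fsumZ (fun m : int => if 0 <= p + 2 * m
     then ((-1) ^ m / (((absz (p + 2 * m)))`!)%:R) *: iter (absz (p + 2 * m)) (@vaL _ V 1) (wtcomp v m)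
     else 0).

(* coefficient of x^s in  Y_2^o(v,x) w = Y_2(e^{xL(1)}(-x^{-2})^{L(0)} v, x^{-1}) w *)
Definition oppYcoef (v : V) (s : int) (w : W2) : W2 :=
  fsumZ (fun p => @mY _ _ _ _ W2 (oppvec v p) (s - p - 1) w).

(* coefficient of x^s in  Y'_{P(z)}(v,x) l :
   l(w1 (x) Y_2^o(v,x) w2)
   + Res_{x0} z^{-1} delta((x^{-1}-x0)/z) l(Y_1(e^{xL(1)}(-x^{-2})^{L(0)}v, x0) w1 (x) w2),
   where z^{-1}delta((x^{-1}-x0)/z) = sum_n sum_{k>=0} z^{-n-1} binom(n,k) x^{-(n-k)} (-x0)^k *)
Definition Ypcoef (v : V) (s : int) (l : X) : X := fun w1 w2 =>
  l w1 (oppYcoef v s w2) +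
  fsumZ (fun p => fsumN (fun k : nat =>
     z ^ (- (k%:Z + p - s) - 1) * binz (k%:Z + p - s) k * (-1) ^+ k *
     l (@mY _ _ _ _ W1 (oppvec v p) k%:Z w1) w2)).

Definition tauP (v : V) (n : int) (l : X) : X := Ypcoef v (- n - 1) l.

Definition LP (j : int) (l : X) : X := fun w1 w2 =>
  l w1 (@mL _ _ _ _ W2 (- j) w2) +
  \sum_(i < (absz (1 - j)).+1) ('C((absz (1 - j)), i))%:R * z ^+ i * l (@mL _ _ _ _ W1 (- j - i%:Z) w1) w2.

Definition compat_a (l : X) :=
  forall v : V, exists N : int, forall s, s < N -> forall w1 w2, Ypcoef v s l w1 w2 = 0.

(* (b), compared coefficient of x0^a x1^b.  Expansions:
   x0^{-1}delta((x1^{-1}-z)/x0) = sum_n sum_{k>=0} binom(n,k) x0^{-n-1} x1^{-(n-k)} (-z)^k,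
   z^{-1}delta((x1^{-1}-x0)/z) = sum_n sum_{k>=0} binom(n,k) z^{-n-1} x1^{-(n-k)} (-x0)^k,
   x0^{-1}delta((z-x1^{-1})/(-x0)) = sum_n sum_{k>=0} binom(n,k) (-x0)^{-n} x0^{-1} z^{n-k} (-x1^{-1})^k. *)
Definition compat_b (l : X) :=
  forall (v : V) w1 w2 (a b : int),
    fsumN (fun k : nat => binz (- a - 1) k * (- z) ^+ k * Ypcoef v (b - a - 1 - k%:Z) l w1 w2)
    =
    fsumZ (fun p => fsumN (fun k : nat =>
        z ^ (- (k%:Z + p - b) - 1) * binz (k%:Z + p - b) k * (-1) ^+ k *
        l (@mY _ _ _ _ W1 (oppvec v p) (k%:Z - a - 1) w1) w2))
    + (-1) ^ (a + 1) * fsumN (fun k : nat =>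
        binz (- a - 1) k * z ^ (- a - 1 - k%:Z) * (-1) ^+ k * l w1 (oppYcoef v (b + k%:Z) w2)).

Definition COMP (l : X) := bilinearX l /\ compat_a l /\ compat_b l.

Definition dualG (b : At) (l : X) :=
  bilinearX l /\
  forall g1 g2 (w1 : W1) (w2 : W2), g1 + g2 != - b ->
    gspan (@mG _ _ _ _ W1) g1 w1 -> gspan (@mG _ _ _ _ W2) g2 w2 -> l w1 w2 = 0.

Definition dualGE (gen : bool) (n : C) (b : At) (l : X) :=
  dualG b l /\
  if gen then exists k : nat, forall w1 w2,
      iter k (fun m : X => fun w1 w2 => LP 0 m w1 w2 - n * m w1 w2) l w1 w2 = 0
  else forall w1 w2, LP 0 l w1 w2 = n * l w1 w2.

Definition Dsp (gen : bool) (l : X) :=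
  exists (s : seq (C * At)) (c : C * At -> X), (forall i, dualGE gen i.1 i.2 (c i)) /\
    forall w1 w2, l w1 w2 = \sum_(i <- s) c i w1 w2.
Definition Dsp_b (gen : bool) (b : At) (l : X) :=
  exists (s : seq C) (c : C -> X), (forall n, dualGE gen n b (c n)) /\
    forall w1 w2, l w1 w2 = \sum_(n <- s) c n w1 w2.

Definition subspaceX (U : X -> Prop) :=
  U (fun _ _ => 0) /\ forall (a : C) m m', U m -> U m' -> U (fun w1 w2 => a * m w1 w2 + m' w1 w2).

Definition gradedX (gen : bool) (U : X -> Prop) :=
  forall m, U m -> exists (s : seq At) (c : At -> X),
    (forall b, U (c b) /\ Dsp_b gen b (c b)) /\
    forall w1 w2, m w1 w2 = \sum_(b <- s) c b w1 w2.

Definition admissible (gen : bool) (l : X) (U : X -> Prop) :=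
  (forall m, U m -> Dsp gen m) /\ subspaceX U /\ gradedX gen U /\ U l /\
  (forall v n m, U m -> U (tauP v n m)) /\
  (forall j, j \in minus1to1 -> forall m, U m -> U (LP j m)).

Definition Wl (gen : bool) (l : X) (m : X) := forall U, admissible gen l U -> U m.

Definition findimX (P : X -> Prop) :=
  exists s : seq X, forall m, P m -> exists c : nat -> C, forall w1 w2,
    m w1 w2 = \sum_(i < size s) c i * nth (fun _ _ => 0) s i w1 w2.

Definition LGR (gen : bool) (l : X) :=
  bilinearX l /\ Dsp gen l /\
  forall (n : C) (b : At),
    findimX (fun m => Wl gen l m /\ dualGE gen n b m) /\
    exists K : int, forall k : int, k < K -> forall m,
      Wl gen l m -> dualGE gen (n + k%:~R) b m -> forall w1 w2, m w1 w2 = 0.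

Definition stableX (P : X -> Prop) :=
  forall l, P l ->
    (forall (v : V) (n : int), P (tauP v n l)) /\
    (forall j, j \in minus1to1 -> P (LP j l)).

End Dual.

(* Main.v *)
(** Removing e^{xL(1)}(-x^{-2})^{L(0)} from Y'_{P(z)} leaves operators dual to
    u (x) f(t), f in C[t, t^{-1}, (t - z)^{-1}], acting on W1 by expanding f at
    t = z and on W2 by expanding f at t = 0.  In these terms compatibility says
    that u (x) f acts on lambda through the expansion of f at infinity (and that
    this expansion makes sense).  The operators u (x) t^m and L'(j) normalize
    the family u (x) f, and the commutators involve only t^k f, hence commute
    with expansion at infinity; so they preserve compatibility.  The removal is
    legitimate because L(1) is locally nilpotent on V.

    For the local grading restriction, the same commutators show that the sum of
    the doubly graded (generalized) eigenspaces is stable; and every subspace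
    admissible for lambda is admissible for its images under the operators, so
    W_{T lambda} is contained in W_lambda. *)
From Stdlib Require Import ClassicalEpsilon FunctionalExtensionality.
Require Import Defs.
From mathcomp Require Import all_boot all_order all_algebra.
From mathcomp Require Import zify ring ssrAC.
Import Order.TTheory GRing.Theory Num.Theory.
Local Open Scope ring_scope.
Set Implicit Arguments. Unset Strict Implicit. Unset Printing Implicit Defensive.
(* Otherwise unification and [ring] unfold C to pairs of Stdlib reals. *)
Local Opaque C.

(** * Formal sums and binomial coefficients *)

(** A function of t looks different on the two factors: t^m is a monomial at W2, but the infinite
    series (z + x0)^m at W1, and the roles are exchanged for (t - z)^c. Every such series is a power
    (s + S)^c of a translated shift S, acting on sequences that vanish for large index. On these
    sequences s + S is injective when s is nonzero, which gives additivity of exponents for negative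
    c as well. The remaining tool is that divided derivatives of (s + S)^m are multiples of lower
    powers; it makes the commutators on W1 agree, coefficient by coefficient, with those on W2.

    The opposite factor is removed one property at a time: a property of series closed under linear
    combinations and exponent shifts holds for all modes exactly when it holds for all opposite
    series. Truncation and the vanishing of the compatibility defect are both of this kind. *)

Lemma sum_fsuppN (M : zmodType) (f : nat -> M) N K : fsuppN f N -> (N <= K)%N ->
  \sum_(i < K) f i = \sum_(i < N) f i.
Proof.
move=> fN NK; rewrite -(subnKC NK) big_split_ord /= [X in _ + X]big1 ?addr0 //.
by move=> i _; apply: fN; rewrite leq_addr.
Qed.

(** The bound inside [fsumN] is an arbitrary choice of [epsilon]; any two valid bounds give the sum
    taken up to their maximum. *)
Lemma fsumNE (M : zmodType) (f : nat -> M) N : fsuppN f N ->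
  fsumN f = \sum_(i < N) f i.
Proof.
move=> fN; rewrite /fsumN.
have hE : fsuppN f (epsilon (inhabits 0%N) (fsuppN f)).
  by apply: epsilon_spec; exists N.
set N0 := epsilon _ _ in hE *.
by rewrite -(sum_fsuppN hE (leq_maxl N0 N)) (sum_fsuppN fN (leq_maxr N0 N)).
Qed.

Lemma sum_fsuppZ (M : zmodType) (f : int -> M) N d : fsuppZ f N ->
  \sum_(i < ((N + d) + (N + d)).+1) f (i%:Z - (N + d)%N%:Z) =
  \sum_(i < (N + N).+1) f (i%:Z - N%:Z).
Proof.
move=> fN; elim: d => [|d IH]; first by rewrite addn0.
rewrite -IH.
have -> : ((N + d.+1) + (N + d.+1)).+1 = ((N + d) + (N + d)).+1.+2 by lia.
rewrite big_ord_recl big_ord_recr /= [f _]fN ?add0r; last by lia.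
rewrite [X in _ + X]fN ?addr0; last by rewrite /bump /=; lia.
by apply: eq_bigr => i _; congr f; rewrite /bump /=; lia.
Qed.

Lemma fsumZE (M : zmodType) (f : int -> M) N : fsuppZ f N ->
  fsumZ f = \sum_(i < (N + N).+1) f (i%:Z - N%:Z).
Proof.
move=> fN; rewrite /fsumZ.
have hE : fsuppZ f (epsilon (inhabits 0%N) (fsuppZ f)).
  by apply: epsilon_spec; exists N.
set N0 := epsilon _ _ in hE *.
by rewrite -(sum_fsuppZ N hE) -(sum_fsuppZ N0 fN) (addnC N).
Qed.

Lemma eq_fsumN (M : zmodType) (f g : nat -> M) : f =1 g -> fsumN f = fsumN g.
Proof. by move=> fg; congr fsumN; apply: functional_extensionality. Qed.

Lemma eq_fsumZ (M : zmodType) (f g : int -> M) : f =1 g -> fsumZ f = fsumZ g.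
Proof. by move=> fg; congr fsumZ; apply: functional_extensionality. Qed.

Lemma fsumN0 (M : zmodType) (f : nat -> M) : (forall p, f p = 0) -> fsumN f = 0.
Proof. by move=> f0; apply: big1 => i _; apply: f0. Qed.

Lemma binz0 r : binz r 0 = 1.
Proof. by rewrite /binz big_ord0 fact0 divr1. Qed.

Lemma binz1 r : binz r 1 = r%:~R.
Proof. by rewrite /binz big_ord1 subr0 divr1. Qed.

Lemma fact_neq0C n : (n`!)%:R != 0 :> C.
Proof. by rewrite pnatr_eq0 -lt0n fact_gt0. Qed.

Lemma binz_small (r i : nat) : (r < i)%N -> binz r i = 0.
Proof.
move=> ri; rewrite /binz (bigD1 (Ordinal ri)) //=.
by rewrite subrr !mul0r.
Qed.

Lemma binz0S i : binz 0 i.+1 = 0.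
Proof. exact: (@binz_small 0 i.+1). Qed.

Lemma binzS r i : i.+1%:R * binz r i.+1 = (r%:~R - i%:R) * binz r i.
Proof.
rewrite /binz big_ord_recr /= factS natrM.
have h1 := fact_neq0C i; have h2 : i.+1%:R != 0 :> C by rewrite pnatr_eq0.
by field; rewrite h1 nat1r h2.
Qed.

(** After multiplication by the lower index, absorption ([binzS]) reduces the rule to the previous
    index. This works for negative r too. *)
Lemma binz_pascal r i : binz (r + 1) i.+1 = binz r i.+1 + binz r i.
Proof.
elim: i => [|i IH]; first by rewrite !binz1 !binz0 intrD.
apply: (@mulfI _ (i.+2)%:R); first by rewrite pnatr_eq0.
rewrite mulrDr !binzS IH mulrDr.
have := binzS r i; move: (binz r i) (binz r i.+1) => x y.
rewrite intrD -(nat1r i.+1) -(nat1r i) => h.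
have -> : (r%:~R + 1%:~R - (1 + i%:R)) * x = (1 + i%:R) * y by rewrite h; ring.
by ring.
Qed.

Lemma prod_falling (r : int) i l :
  \prod_(j < i + l) (r%:~R - j%:R) =
  \prod_(j < i) (r%:~R - j%:R) * \prod_(j < l) ((r - i%:Z)%:~R - j%:R) :> C.
Proof.
rewrite big_split_ord /=; congr (_ * _); apply: eq_bigr => j _.
by rewrite natrD intrD intrN opprD addrA.
Qed.

Lemma prod_falling_fact i : \prod_(j < i) (i%:R - j%:R) = (i`!)%:R :> C.
Proof.
elim: i => [|i IH]; first by rewrite big_ord0.
rewrite big_ord_recl /= subr0 factS natrM -IH; congr (_ * _).
by apply: eq_bigr => j _; rewrite /bump /= add1n -!(nat1r _); ring.
Qed.

(** Both sides are the falling factorial of m of length i + l divided by i! l!. This is the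
    coefficient form of the divided derivative rule [spow_binz]. *)
Lemma binz_trinomial (m : int) i l :
  binz m (i + l) * binz (i + l)%N i = binz m i * binz (m - i%:Z) l.
Proof.
have e : \prod_(j < i) ((i + l)%N%:~R - j%:R) * (l`!)%:R = ((i + l)`!)%:R :> C.
  rewrite -(prod_falling_fact (i + l)) (prod_falling (i + l)%N) -prod_falling_fact.
  by congr (_ * _); apply: eq_bigr => j _; rewrite PoszD addrAC subrr add0r.
rewrite /binz prod_falling -e.
have h1 := fact_neq0C i; have h2 := fact_neq0C l.
have h3 : \prod_(j < i) ((i + l)%N%:~R - j%:R) != 0 :> C.
  by have := fact_neq0C (i + l); rewrite -e; apply: contraNneq => ->; rewrite mul0r.
by field; rewrite h1 h2 h3.
Qed.

(** Upper negation. It converts the coefficients of the delta function in (x^{-1} - x0)/z into those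
    of a power of z + x0. *)
Lemma binz_neg (r : int) k : binz (k%:Z - 1 - r) k * (-1) ^+ k = binz r k.
Proof.
rewrite /binz mulrAC; congr (_ / _).
have -> : (-1) ^+ k = \prod_(j < k) (-1) :> C by rewrite prodr_const card_ord.
rewrite -big_split /= [LHS](reindex_inj rev_ord_inj) /=; apply: eq_bigr => j _.
rewrite natrB // -natr1 !intrD !intrN.
have : (k%:R = k%:~R :> C) by [].
by move=> ->; ring.
Qed.

(** * Powers of a translated shift *)

Section ShiftPower.
Variable M : lmodType C.
Implicit Types (f g : int -> M) (s : C) (c m n N : int).

Definition above (N : int) f := forall n, N < n -> f n = 0.

(* The operator (s + S)^c on sequences, S being the shift f |-> f (. + 1). *)
Definition spow s (c : int) f (n : int) : M :=
  fsumN (fun k => (binz c k * s ^ (c - k%:Z)) *: f (n + k%:Z)).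

Lemma spow_supp s c f N n (K : nat) : above N f -> N < n + K%:Z ->
  fsuppN (fun k => (binz c k * s ^ (c - k%:Z)) *: f (n + k%:Z)) K.
Proof. by move=> fN hK k Kk /=; rewrite fN ?scaler0 //; lia. Qed.

Lemma spowE s c f N n (K : nat) : above N f -> N < n + K%:Z ->
  spow s c f n = \sum_(k < K) (binz c k * s ^ (c - k%:Z)) *: f (n + k%:Z).
Proof. by move=> fN hK; apply: fsumNE; apply: spow_supp fN hK. Qed.

Lemma above_spow s c f N : above N f -> above N (spow s c f).
Proof. by move=> fN n Nn; rewrite (@spowE _ _ _ N _ 0) ?big_ord0 //; lia. Qed.

Lemma spow0 s f N : above N f -> spow s 0 f =1 f.
Proof.
move=> fN n; rewrite /spow (@fsumNE _ _ 1); last first.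
  by move=> [|k] // _; rewrite binz0S mul0r scale0r.
by rewrite big_ord1 binz0 mul1r subrr expr0z scale1r addr0.
Qed.

Lemma spowS s c f N n : s != 0 -> above N f ->
  spow s (c + 1) f n = s *: spow s c f n + spow s c f (n + 1).
Proof.
move=> s0 fN; pose K := absz (N - n + 1).
have hK : N < n + K%:Z by lia.
rewrite !(@spowE _ _ _ N n K.+1) //; [|lia..].
rewrite (@spowE _ _ _ N (n + 1) K) //; [|lia].
rewrite !big_ord_recl /= scalerDr -[RHS]addrA; congr (_ + _).
  by rewrite !binz0 !mul1r scalerA !subr0 expfzDr // expr1z mulrC.
rewrite scaler_sumr -big_split /=; apply: eq_bigr => k _.
rewrite /bump /= add1n scalerA.
have -> : n + 1 + k%:Z = n + k.+1%:Z by lia.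
rewrite -scalerDl; congr (_ *: _).
rewrite binz_pascal.
have -> : c + 1 - k.+1%:Z = c - k%:Z by lia.
have -> : c - k%:Z = (c - k.+1%:Z) + 1 by lia.
by rewrite expfzDr // expr1z; ring.
Qed.

Lemma spow_shift s c f a n : spow s c (fun k => f (k + a)) n = spow s c f (n + a).
Proof. by apply: eq_fsumN => k; rewrite addrAC. Qed.

Lemma shift_inj s f N : s != 0 -> above N f ->
  (forall n, s *: f n + f (n + 1) = 0) -> forall n, f n = 0.
Proof.
move=> s0 fN fr n.
suff H : forall d : nat, forall n, N - d%:Z < n -> f n = 0.
  by apply: (H (absz (N - n + 1))); lia.
elim=> [|d IH] {}n Nn; first by apply: fN; lia.
have := fr n; rewrite [f (n + 1)]IH ?addr0; last by lia.
by move/eqP; rewrite scaler_eq0 (negbTE s0) => /eqP.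
Qed.

(** Going up from c = 0 the recursion computes G. Going down it only prescribes (s + S) applied to G
    c, and [shift_inj] says that this determines G c among sequences bounded above. *)
Lemma spow_unique s f N (G : int -> int -> M) : s != 0 -> above N f ->
  (forall c, above N (G c)) -> G 0 =1 f ->
  (forall c n, G (c + 1) n = s *: G c n + G c (n + 1)) ->
  forall c n, G c n = spow s c f n.
Proof.
move=> s0 fN GN G0 GS; elim/int_ind=> [n|c IH n|c IH n].
- by rewrite (spow0 _ fN) G0.
- have -> : c.+1%:Z = c%:Z + 1 by lia.
  by rewrite GS (spowS _ _ s0 fN) !IH.
- apply/eqP; rewrite -subr_eq0; apply/eqP; move: n.
  have hN := above_spow s (- (c.+1%:Z)) fN.
  apply: (@shift_inj s _ N s0) => [n Nn|n].
    by rewrite GN // hN // subr0.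
  rewrite scalerBr addrACA -opprD -GS -(spowS _ _ s0 fN).
  have -> : - c.+1%:Z + 1 = - c%:Z by lia.
  by rewrite IH subrr.
Qed.

(** Vandermonde's convolution in disguise: as a function of a, the right side satisfies the
    recursion that characterizes powers of s + S. *)
Lemma spow_comp s a c f N n : s != 0 -> above N f ->
  spow s a (spow s c f) n = spow s (c + a) f n.
Proof.
move=> s0 fN; have cN := above_spow s c fN; symmetry.
apply: (@spow_unique s _ N (fun a n => spow s (c + a) f n)) => //.
- by move=> b; apply: above_spow.
- by move=> m; rewrite addr0.
- by move=> b m; rewrite addrA (spowS _ _ s0 fN).
Qed.

(* ((s + S)^m)^(i) / i! = binom(m, i) (s + S)^(m - i), read on coefficients. *)
Lemma spow_binz s m i f N n : above N f ->
  spow s m (fun k => binz (k - n) i *: f (k - i%:Z)) n =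
  binz m i *: spow s (m - i%:Z) f n.
Proof.
move=> fN; pose K := absz (N - n + 1).
rewrite (@spowE _ _ _ (N + i%:Z) _ (i + K)); last 2 first.
- by move=> k hk; rewrite fN ?scaler0 //; lia.
- by lia.
rewrite (@spowE _ _ _ N _ K) //; last by lia.
(* The first i terms carry binom(j, i) with j < i and vanish; the others match by the trinomial
   identity. *)
rewrite big_split_ord /= [X in X + _]big1 ?add0r; last first.
  by move=> j _; rewrite addrAC subrr add0r binz_small ?ltn_ord // scale0r scaler0.
rewrite scaler_sumr; apply: eq_bigr => l _; rewrite !scalerA.
have -> : n + (i + l)%N%:Z - n = (i + l)%N by lia.
have -> : n + (i + l)%N%:Z - i%:Z = n + l%:Z by lia.
have -> : m - (i + l)%N%:Z = m - i%:Z - l%:Z by lia.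
by congr (_ *: _); rewrite mulrAC binz_trinomial mulrA.
Qed.

Lemma spow_lin s c (a : C) f g N n : above N f -> above N g ->
  spow s c (fun k => a *: f k + g k) n = a *: spow s c f n + spow s c g n.
Proof.
move=> fN gN; pose K := absz (N - n + 1).
have fgN : above N (fun k => a *: f k + g k).
  by move=> k hk; rewrite fN // gN // scaler0 addr0.
rewrite !(@spowE _ _ _ N _ K) //; [|lia..].
rewrite scaler_sumr -big_split; apply: eq_bigr => k _ /=.
by rewrite scalerDr !scalerA [a * _]mulrC.
Qed.

Lemma eq_spow s c f g n : f =1 g -> spow s c f n = spow s c g n.
Proof. by move=> fg; apply: eq_fsumN => k; rewrite fg. Qed.

Lemma spow_zero s c n : spow s c (fun=> 0) n = 0.
Proof. by apply: fsumN0 => k; rewrite scaler0. Qed.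

Lemma spow_sum s c (I : Type) (r : seq I) (a : I -> C) (f : I -> int -> M) N n :
  (forall i, above N (f i)) ->
  spow s c (fun k => \sum_(i <- r) a i *: f i k) n = \sum_(i <- r) a i *: spow s c (f i) n.
Proof.
move=> fN; elim: r => [|i r IH].
  by rewrite big_nil -[RHS](spow_zero s c n); apply: eq_spow => k; rewrite big_nil.
rewrite big_cons -IH -(spow_lin _ _ _ _ (fN i)) //.
  by apply: eq_spow => k; rewrite big_cons.
by move=> k hk; apply: big1 => j _; rewrite fN // scaler0.
Qed.

End ShiftPower.

Lemma lin0 (M M' : lmodType C) (F : M -> M') : linear F -> F 0 = 0.
Proof. by move=> Fl; have := Fl (-1) 0 0; rewrite scaler0 addr0 scaleN1r addNr. Qed.

Lemma linZ (M M' : lmodType C) (F : M -> M') : linear F -> forall a x, F (a *: x) = a *: F x.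
Proof. by move=> Fl a x; have := Fl a x 0; rewrite !addr0 (lin0 Fl) addr0. Qed.

Lemma linD (M M' : lmodType C) (F : M -> M') : linear F -> forall x y, F (x + y) = F x + F y.
Proof. by move=> Fl x y; have := Fl 1 x y; rewrite !scale1r. Qed.

Lemma lin_sum (M M' : lmodType C) (F : M -> M') (I : Type) (r : seq I) (P : pred I) (g : I -> M) :
  linear F -> F (\sum_(i <- r | P i) g i) = \sum_(i <- r | P i) F (g i).
Proof. by move=> Fl; apply: (big_morph F (linD Fl) (lin0 Fl)). Qed.

Lemma linear_spow (M M' : lmodType C) (F : M -> M') s c f N n :
  linear F -> above N f -> F (spow s c f n) = spow s c (F \o f) n.
Proof.
move=> Fl fN; pose K := absz (N - n + 1).
have FfN : above N (F \o f) by move=> k hk /=; rewrite fN // lin0.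
rewrite !(@spowE _ _ _ _ N _ K) //; [|lia..].
by rewrite (lin_sum _ _ _ Fl); apply: eq_bigr => k _; rewrite (linZ Fl).
Qed.

(** * Modes of u (x) (s + t)^c t^n on a module *)

Lemma above_le (M : lmodType C) (f : int -> M) N N' : N <= N' -> above N f -> above N' f.
Proof. by move=> h fN n hn; apply: fN; apply: le_lt_trans hn. Qed.

Lemma above_family (M : lmodType C) (K : nat) (f : nat -> int -> M) :
  (forall i, exists N, above N (f i)) -> exists N, forall i : 'I_K, above N (f i).
Proof.
move=> fN; elim: K => [|K [N IH]]; first by exists 0 => -[].
have [N' hN'] := fN K; exists (Num.max N N') => i.
have := ltn_ord i; rewrite ltnS leq_eqVlt => /orP [/eqP ->|iK].
  by apply: above_le hN'; rewrite le_max lexx orbT.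
by apply: above_le (IH (Ordinal iK)); rewrite le_max lexx.
Qed.

Section LowBinomialSums.
Variables (M : lmodType C) (F : nat -> M).

Lemma sum_binN1 : \sum_(k < (absz (-1 + 1)).+1) 'C(absz (-1 + 1), k)%:R *: F k = F 0%N.
Proof. by rewrite big_ord1 bin0 scale1r. Qed.

Lemma sum_bin0 : \sum_(k < (absz (0 + 1)).+1) 'C(absz (0 + 1), k)%:R *: F k = F 0%N + F 1%N.
Proof. by rewrite !big_ord_recr big_ord0 /= add0r !scale1r. Qed.

Lemma sum_bin1 : \sum_(k < (absz (1 + 1)).+1) 'C(absz (1 + 1), k)%:R *: F k =
  F 0%N + 2%:R *: F 1%N + F 2%N.
Proof. by rewrite !big_ord_recr big_ord0 /= add0r !scale1r. Qed.
End LowBinomialSums.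

Section Modes.
Variables (A At : zmodType) (iota : A -> At) (V : SGMobiusVA A).
Variable W : SGGenModule iota V.
Implicit Types (u v : V) (w : W) (s : C) (c j m n : int).

Lemma vaY_trunc u v : exists K : nat, forall i : nat, (K <= i)%N -> vaY u i v = 0.
Proof.
have [N hN] := @va_trunc _ V u v; exists (absz N).+1 => i hi; apply: hN; lia.
Qed.

Lemma mY_above u w : exists N, above N (fun k => @mY _ _ _ _ W u k w).
Proof. exact: m_trunc. Qed.

Lemma mY_lin1 n w : linear (fun u => @mY _ _ _ _ W u n w).
Proof. by move=> a u v; apply: m_Ylin1. Qed.

Lemma mY_lin2 u n : linear (@mY _ _ _ _ W u n).
Proof. by move=> a x y; apply: m_Ylin2. Qed.

Lemma mY_comm u v m n w (K : nat) : (forall i : nat, (K <= i)%N -> vaY v i u = 0) ->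
  @mY _ _ _ _ W v m (mY u n w) - mY u n (mY v m w) =
  \sum_(i < K) binz m i *: mY (vaY v i%:Z u) (n + m - i%:Z) w.
Proof.
move=> hK; have := @m_jacobi _ _ _ _ W v u w m n 0.
(* Taking r = 0 in the Jacobi identity leaves only the term i = 0 on its right side, which is the
   commutator. *)
rewrite (@fsumNE _ _ K); last first.
  by move=> i /hK vi0; rewrite add0r vi0 (lin0 (mY_lin1 _ _)) scaler0.
rewrite (@fsumNE _ _ 1); last first.
  by move=> [|i] // _; rewrite binz0S mulr0 scale0r.
rewrite big_ord1 /= expr0z expr0 binz0 mulr1 !scale1r !add0r !subr0 => <-.
by apply: eq_bigr => i _; rewrite add0r [m + n]addrC.
Qed.

(* The component of [u (x) (s + t)^c t^n] acting on W. *)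
Definition Eop s c n u w : W := spow s c (fun k => mY u k w) n.

Lemma Eop_lin1 s c n w : linear (fun u => Eop s c n u w).
Proof.
move=> a u v; have [N1 h1] := mY_above u w; have [N2 h2] := mY_above v w.
rewrite /Eop -(@spow_lin _ _ _ _ _ _ (Num.max N1 N2)); last 2 first.
- by apply: above_le h1; rewrite le_max lexx.
- by apply: above_le h2; rewrite le_max lexx orbT.
by apply: eq_spow => k; rewrite m_Ylin1.
Qed.

Lemma Eop_lin2 s c n u : linear (Eop s c n u).
Proof.
move=> a w w'; have [N1 h1] := mY_above u w; have [N2 h2] := mY_above u w'.
rewrite /Eop -(@spow_lin _ _ _ _ _ _ (Num.max N1 N2)); last 2 first.
- by apply: above_le h1; rewrite le_max lexx.
- by apply: above_le h2; rewrite le_max lexx orbT.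
by apply: eq_spow => k; rewrite m_Ylin2.
Qed.

Lemma Eop_above s c u w : exists N, above N (fun n => Eop s c n u w).
Proof. by have [N hN] := mY_above u w; exists N; apply: above_spow. Qed.

Lemma Eop0 s n u w : Eop s 0 n u w = mY u n w.
Proof. by have [N hN] := mY_above u w; apply: (spow0 _ hN). Qed.

Lemma EopS s c n u w : s != 0 ->
  Eop s (c + 1) n u w = s *: Eop s c n u w + Eop s c (n + 1) u w.
Proof. by move=> s0; have [N hN] := mY_above u w; apply: (spowS _ _ s0 hN). Qed.

(** The power (s + S)^c acts on the mode index of u only, so it passes termwise through the
    commutator formula [mY_comm]. *)
Lemma mY_Eop_comm s c n u v m w (K : nat) :
  (forall i : nat, (K <= i)%N -> vaY v i u = 0) ->
  @mY _ _ _ _ W v m (Eop s c n u w) - Eop s c n u (mY v m w) =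
  \sum_(i < K) binz m i *: Eop s c (n + m - i%:Z) (vaY v i%:Z u) w.
Proof.
move=> hK; have [N1 h1] := mY_above u w; have [N2 h2] := mY_above u (mY v m w).
pose N := Num.max N1 N2.
have h1' : above N (fun k => @mY _ _ _ _ W u k w).
  by apply: above_le h1; rewrite le_max lexx.
have h2' : above N (fun k => @mY _ _ _ _ W u k (mY v m w)).
  by apply: above_le h2; rewrite le_max lexx orbT.
rewrite /Eop (linear_spow _ _ _ (mY_lin2 v m) h1').
rewrite addrC -scaleN1r -(@spow_lin _ _ _ _ _ _ N) //; last first.
  by move=> k hk /=; rewrite h1' // (lin0 (mY_lin2 v m)).
pose F (i : nat) k := @mY _ _ _ _ W (vaY v i u) (k + (m - i%:Z)) w.
have [N3 h3] : exists N, forall i : 'I_K, above N (F i).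
  apply: above_family => i; have [N3 h3] := mY_above (vaY v i u) w.
  by exists (N3 - (m - i%:Z)) => k hk; apply: h3; lia.
under eq_bigr do rewrite -addrA -[spow _ _ _ _]spow_shift.
rewrite -(@spow_sum _ _ _ _ _ (fun i : 'I_K => binz m i) F _ _ h3).
apply: eq_spow => k; rewrite scaleN1r addrC /= (mY_comm _ _ _ hK).
by apply: eq_bigr => i _; rewrite /F addrA.
Qed.

(** Here v also carries a power, (s + t)^m. Applying (s + S)^m to [mY_Eop_comm] meets the factors
    binom(k, i) with an index shifted by i; [spow_binz] turns them into binom(m, i) (s + S)^(m - i),
    and [spow_comp] merges this power with (s + S)^c. *)
Lemma Eop_comm s c n u v m w (K : nat) : s != 0 ->
  (forall i : nat, (K <= i)%N -> vaY v i u = 0) ->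
  Eop s m 0 v (Eop s c n u w) - Eop s c n u (Eop s m 0 v w) =
  \sum_(i < K) binz m i *: Eop s (c + m - i%:Z) n (vaY v i%:Z u) w.
Proof.
move=> s0 hK; have [N1 h1] := mY_above v (Eop s c n u w).
have [N2 h2] := mY_above v w; pose N := Num.max N1 N2.
have h1' : above N (fun k => @mY _ _ _ _ W v k (Eop s c n u w)).
  by apply: above_le h1; rewrite le_max lexx.
have h2' : above N (fun k => @mY _ _ _ _ W v k w).
  by apply: above_le h2; rewrite le_max lexx orbT.
rewrite {1 5}/Eop (linear_spow _ _ _ (Eop_lin2 s c n u) h2').
rewrite addrC -scaleN1r -(@spow_lin _ _ _ _ _ _ N) //; last first.
  by move=> k hk /=; rewrite h2' // (lin0 (Eop_lin2 s c n u)).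
pose H (i : nat) k := Eop s c (n + k) (vaY v i u) w.
have HN i : exists N, above N (H i).
  have [N3 h3] := Eop_above s c (vaY v i u) w.
  by exists (N3 - n) => k hk; apply: h3; lia.
pose F (i : nat) k := binz k i *: H i (k - i%:Z).
have [N3 h3] : exists N, forall i : 'I_K, above N (F i).
  apply: above_family => i; have [N3 h3] := HN i.
  by exists (N3 + i%:Z) => k hk; rewrite /F h3 ?scaler0 //; lia.
transitivity (spow s m (fun k => \sum_(i < K) 1 *: F i k) 0).
  apply: eq_spow => k; rewrite scaleN1r addrC /= (mY_Eop_comm _ _ _ _ _ hK).
  by apply: eq_bigr => i _; rewrite scale1r /F /H addrA.
rewrite (@spow_sum _ _ _ _ _ (fun i : 'I_K => 1) F _ _ h3).
apply: eq_bigr => i _; rewrite scale1r; have [N4 h4] := HN i.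
have := @spow_binz _ s m i (H i) N4 0 h4; rewrite (@eq_spow _ _ _ _ (F i)); last first.
  by move=> k; rewrite subr0.
move=> ->; congr (_ *: _); have [N5 h5] := mY_above (vaY v i u) w.
rewrite -addrA -(spow_comp _ _ _ s0 h5) -[n in RHS]add0r -spow_shift.
by apply: eq_spow => k; rewrite /H addrC.
Qed.

(** L(-1) on u acts as -d/dt on the function; the derivative of (s + t)^m is the case i = 1 of
    [spow_binz]. *)
Lemma Eop_Lder s m u w : Eop s m 0 (vaL (-1) u) w = - m%:~R *: Eop s (m - 1) 0 u w.
Proof.
have [N h] := mY_above u w.
have := @spow_binz _ s m 1 _ N 0 h; rewrite binz1 scaleNr => <-.
rewrite -scaleN1r -[RHS]addr0 -[X in _ + X](spow_zero W s m 0).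
rewrite -(@spow_lin _ _ _ _ _ _ (N + 1)) //; last first.
  by move=> k hk; rewrite h ?scaler0 //; lia.
apply: eq_spow => k; rewrite addr0 m_Lder subr0 binz1 scaleN1r scaleNr.
by [].
Qed.

Lemma mL_lin j : linear (@mL _ _ _ _ W j).
Proof. by move=> a x y; apply: m_Llin. Qed.

Lemma mL_Eop_comm j s c n u w : j \in minus1to1 ->
  @mL _ _ _ _ W j (Eop s c n u w) - Eop s c n u (mL j w) =
  \sum_(k < (absz (j + 1)).+1)
     ('C((absz (j + 1)), k))%:R *: Eop s c (n + k%:Z) (vaL (j - k%:Z) u) w.
Proof.
move=> hj; have [N1 h1] := mY_above u w; have [N2 h2] := mY_above u (mL j w).
pose N := Num.max N1 N2.
have h1' : above N (fun k => @mY _ _ _ _ W u k w).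
  by apply: above_le h1; rewrite le_max lexx.
have h2' : above N (fun k => @mY _ _ _ _ W u k (mL j w)).
  by apply: above_le h2; rewrite le_max lexx orbT.
rewrite /Eop (linear_spow _ _ _ (mL_lin j) h1').
rewrite addrC -scaleN1r -(@spow_lin _ _ _ _ _ _ N) //; last first.
  by move=> k hk /=; rewrite h1' // (lin0 (mL_lin j)).
pose F (i : nat) k := @mY _ _ _ _ W (vaL (j - i%:Z) u) (k + i%:Z) w.
have [N3 h3] : exists N, forall i : 'I_(absz (j + 1)).+1, above N (F i).
  apply: above_family => i; have [N3 h3] := mY_above (vaL (j - i%:Z) u) w.
  by exists (N3 - i%:Z) => k hk; apply: h3; lia.
under eq_bigr do rewrite -spow_shift.
rewrite -(@spow_sum _ _ _ _ _ (fun i : 'I_(absz (j + 1)).+1 => 'C((absz (j + 1)), i)%:R) F _ _ h3).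
by apply: eq_spow => k; rewrite scaleN1r addrC /= m_Lcomm.
Qed.

(* L(j) translated to the point s: the vector field t^(j+1) at t = s + x0. *)
Definition Lop s j w : W :=
  \sum_(i < (absz (j + 1)).+1) ('C((absz (j + 1)), i)%:R * s ^+ i) *: mL (j - i%:Z) w.

Lemma Lop_lin s j : linear (Lop s j).
Proof.
move=> a x y; rewrite /Lop scaler_sumr -big_split; apply: eq_bigr => i _ /=.
by rewrite mL_lin scalerDr !scalerA [_ * a]mulrC.
Qed.

Lemma LopN1 s w : Lop s (-1) w = mL (-1) w.
Proof. rewrite /Lop big_ord1 /= bin0 expr0 mul1r scale1r; congr mL. Qed.

Lemma Lop0 s w : Lop s 0 w = mL 0 w + s *: mL (-1) w.
Proof. by rewrite /Lop !big_ord_recr big_ord0 /= add0r !mul1r expr0 scale1r expr1. Qed.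

Lemma Lop1 s w : Lop s 1 w = mL 1 w + (2%:R * s) *: mL 0 w + s ^+ 2 *: mL (-1) w.
Proof. by rewrite /Lop !big_ord_recr big_ord0 /= add0r !mul1r expr0 scale1r expr1. Qed.

(** In the coordinate s + t the translated vector field is (s + t)^(j+1), so the commutator raises
    the exponent c exactly as [mL_Eop_comm] raises n. Each j is checked by expanding the powers of s
    + t with [EopS]. *)
Lemma Lop_Eop_comm j s c n u w : s != 0 -> j \in minus1to1 ->
  Lop s j (Eop s c n u w) - Eop s c n u (Lop s j w) =
  \sum_(k < (absz (j + 1)).+1)
     ('C((absz (j + 1)), k))%:R *: Eop s (c + k%:Z) n (vaL (j - k%:Z) u) w.
Proof.
move=> s0; pose X m i := Eop s c m (vaL i u) w.
have XS m i : Eop s (c + 1) m (vaL i u) w = s *: X m i + X (m + 1) i by apply: EopS.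
have cN : mL (-1) (Eop s c n u w) - Eop s c n u (mL (-1) w) = X n (-1).
  rewrite (@mL_Eop_comm (-1)) // (sum_binN1 (fun k => Eop s c (n + k%:Z) (vaL (-1 - k%:Z) u) w)).
  by rewrite addr0 subr0.
have c0 : mL 0 (Eop s c n u w) - Eop s c n u (mL 0 w) = X n 0 + X (n + 1) (-1).
  rewrite (@mL_Eop_comm (0)) // (sum_bin0 (fun k => Eop s c (n + k%:Z) (vaL (0 - k%:Z) u) w)).
  by rewrite addr0 subr0 sub0r.
have c1 : mL 1 (Eop s c n u w) - Eop s c n u (mL 1 w) =
    X n 1 + 2%:R *: X (n + 1) 0 + X (n + 2) (-1).
  rewrite (@mL_Eop_comm (1)) // (sum_bin1 (fun k => Eop s c (n + k%:Z) (vaL (1 - k%:Z) u) w)).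
  by rewrite addr0 subr0 subrr.
have El := Eop_lin2 s c n u.
rewrite !inE => /or3P [] /eqP ->.
- rewrite (sum_binN1 (fun k => Eop s (c + k%:Z) n (vaL (-1 - k%:Z) u) w)).
  by rewrite !LopN1 cN subr0 addr0.
- rewrite (sum_bin0 (fun k => Eop s (c + k%:Z) n (vaL (0 - k%:Z) u) w)).
  rewrite !Lop0 (linD El) (linZ El) opprD addrACA -scalerBr c0 cN XS subr0 addr0 sub0r.
  by rewrite -addrA [X (n + 1) _ + _]addrC.
- rewrite (sum_bin1 (fun k => Eop s (c + k%:Z) n (vaL (1 - k%:Z) u) w)).
  rewrite !Lop1 !(linD El) !(linZ El) !opprD addrACA [X in X + _ = _]addrACA.
  rewrite -!scalerBr c1 c0 cN XS subr0 addr0 subrr.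
  have -> : c + 2%:Z = (c + 1) + 1 by lia.
  rewrite !EopS // -!/(X _ _).
  have -> : 1 - 2%:Z = -1 by [].
  have -> : n + 1 + 1 = n + 2 by lia.
  rewrite !scalerDr !scalerA (mulr_natl s 2) mulr2n !scalerDl.
  rewrite -expr2 !addrA.
  by rewrite [LHS](ACl (1*5*6*2*3*9*7*8*4)%AC).
Qed.

(** Translation by s is the automorphism exp(-s ad L(-1)) of sl(2), which preserves brackets; here
    this is verified by expansion. *)
Lemma Lop_sl2 s j w : j \in minus1to1 ->
  Lop s 0 (Lop s j w) - Lop s j (Lop s 0 w) = (- j)%:~R *: Lop s j w.
Proof.
have sl i k x : i \in minus1to1 -> k \in minus1to1 -> (i + k) \in minus1to1 ->
    @mL _ _ _ _ W i (mL k x) = mL k (mL i x) + (i - k)%:~R *: mL (i + k) x.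
  by move=> *; rewrite -m_sl2 // addrC subrK.
have D i := linD (mL_lin i); have Z i := linZ (mL_lin i).
rewrite !inE => /or3P [] /eqP ->.
- rewrite !(LopN1, Lop0) !D !Z (sl 0 (-1)) // !add0r !opprK opprD addrACA.
  by rewrite subrr addr0 addrAC subrr add0r.
- by rewrite subrr oppr0 scale0r.
- rewrite !(Lop1, Lop0) !D !Z (sl 0 1) // (sl 0 (-1)) // (sl 1 (-1)) //.
  rewrite (_ : 1 + -1 = 0) //.
  move: (mL 1 (mL 0 w)) (mL 0 (mL 0 w)) (mL (-1) (mL 0 w)) (mL (-1) (mL 1 w)) (mL (-1) (mL (-1) w)).
  move: (mL 1 w) (mL 0 w) (mL (-1) w) => a b c P Q R S T.
  rewrite !scalerDr !scalerA !opprD !addrA.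
  rewrite [LHS](ACl ((1*9)*(3*12)*(4*15)*(6*10)*(7*13)*(8*16)*(2*11*(5*14)))%AC) /=.
  rewrite !subrr [s * (2 * s)]mulrC [s * s ^+ 2]mulrC !subrr !add0r.
  rewrite -scaleNr -scalerBl -!addrA; congr (_ + (_ *: _ + _ *: _)); ring.
Qed.
End Modes.

(** * The dual action and expansion at infinity *)

Section ExpansionAtInfinity.
Variable z : C.
Implicit Types (g : int -> C) (c n N e : int).

Definition below N g := forall n, n < N -> g n = 0.

(* The pairing of g with t^n (t - z)^c expanded in nonnegative powers of z. *)
Definition ipow c g n : C :=
  fsumN (fun k : nat => binz c k * (- z) ^+ k * g (n + c - k%:Z)).

Lemma ipowE c g N n (K : nat) : below N g -> n + c - K%:Z < N ->
  ipow c g n = \sum_(k < K) binz c k * (- z) ^+ k * g (n + c - k%:Z).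
Proof. by move=> gN hK; apply: fsumNE => k Kk; rewrite gN ?mulr0 //; lia. Qed.

Lemma below_le N N' g : N' <= N -> below N g -> below N' g.
Proof. by move=> h gN n hn; apply: gN; apply: lt_le_trans h. Qed.

Lemma eq_ipow c g g' n : g =1 g' -> ipow c g n = ipow c g' n.
Proof. by move=> gg; apply: eq_fsumN => k; rewrite gg. Qed.

Lemma ipow_lin c (a : C) g1 g2 N1 N2 n : below N1 g1 -> below N2 g2 ->
  ipow c (fun k => a * g1 k + g2 k) n = a * ipow c g1 n + ipow c g2 n.
Proof.
move=> h1 h2; pose N := Num.min N1 N2.
have h1' : below N g1 by apply: below_le h1; rewrite ge_min lexx.
have h2' : below N g2 by apply: below_le h2; rewrite ge_min lexx orbT.
have h12 : below N (fun k => a * g1 k + g2 k).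
  by move=> k hk; rewrite h1' // h2' // mulr0 addr0.
pose K := absz (n + c - N + 1).
rewrite !(@ipowE _ _ N _ K) //; [|lia..].
by rewrite mulr_sumr -big_split; apply: eq_bigr => k _ /=; ring.
Qed.

Lemma ipow_shift c g e n : ipow c (fun k => g (k + e)) n = ipow c g (n + e).
Proof. by apply: eq_fsumN => k; congr (_ * g _); lia. Qed.

Lemma ipow_zero c n : ipow c (fun=> 0) n = 0.
Proof. by apply: fsumN0 => k; rewrite mulr0. Qed.

Lemma below_sum (K : nat) (a : nat -> C) (e : nat -> int) (g : nat -> int -> C) :
  (forall i, exists N, below N (g i)) ->
  exists N, below N (fun k => \sum_(i < K) a i * g i (k + e i)).
Proof.
move=> gN; elim: K => [|K [N IH]]; first by exists 0 => k _; rewrite big_ord0.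
have [N' h'] := gN K; exists (Num.min N (N' - e K)) => k.
rewrite lt_min => /andP [kN kN']; rewrite big_ord_recr /= IH // h' ?mulr0 ?addr0 //; lia.
Qed.

(** Multiplication by a power of t is an index shift, and expansion at infinity commutes with it.
    This lets the commutator terms pass through the expansion. *)
Lemma ipow_sum c (K : nat) (a : nat -> C) (e : nat -> int) (g : nat -> int -> C) n :
  (forall i, exists N, below N (g i)) ->
  ipow c (fun k => \sum_(i < K) a i * g i (k + e i)) n =
  \sum_(i < K) a i * ipow c (g i) (n + e i).
Proof.
move=> gN; elim: K => [|K IH].
  by rewrite big_ord0 -[RHS](ipow_zero c n); apply: eq_ipow => k; rewrite big_ord0.
rewrite big_ord_recr /= -IH addrC -ipow_shift.
have [N hN] := gN K; have [N' hN'] := below_sum K a e gN.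
rewrite -(@ipow_lin _ _ _ _ (N - e K) N') //; last by move=> k hk; apply: hN; lia.
by apply: eq_ipow => k; rewrite big_ord_recr /= addrC.
Qed.
End ExpansionAtInfinity.

Section Dual.
Variables (A At : zmodType) (iota : A -> At) (V : SGMobiusVA A).
Variables (W1 W2 : SGGenModule iota V) (z : C).
Local Notation X := (W1 -> W2 -> C).
Implicit Types (l : X) (u v : V) (c n m : int).

(** The transpose of a coproduct-like action. [Dop] and, on bilinear forms, L'(j) both have this
    shape, so stability is proved for it once. *)
Definition cop (F : W2 -> W2) (G : W1 -> W1) l : X := fun w1 w2 => l w1 (F w2) + l (G w1) w2.

Lemma bil_sum1 l w2 (I : Type) (r : seq I) (a : I -> C) (f : I -> W1) : bilinearX l ->
  l (\sum_(i <- r) a i *: f i) w2 = \sum_(i <- r) a i * l (f i) w2.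
Proof.
move=> [h _]; have l0 : l 0 w2 = 0.
  by have := h w2 (-1) 0 0; rewrite scaler0 addr0 mulN1r addNr.
by elim: r => [|i r IH]; rewrite ?big_nil // !big_cons h IH.
Qed.

Lemma bil_sum2 l w1 (I : Type) (r : seq I) (a : I -> C) (f : I -> W2) : bilinearX l ->
  l w1 (\sum_(i <- r) a i *: f i) = \sum_(i <- r) a i * l w1 (f i).
Proof.
move=> [_ h]; have l0 : l w1 0 = 0.
  by have := h w1 (-1) 0 0; rewrite scaler0 addr0 mulN1r addNr.
by elim: r => [|i r IH]; rewrite ?big_nil // !big_cons h IH.
Qed.

Lemma bilD1 l w2 x y : bilinearX l -> l (x + y) w2 = l x w2 + l y w2.
Proof. by move=> [h _]; have := h w2 1 x y; rewrite scale1r mul1r. Qed.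

Lemma bilD2 l w1 x y : bilinearX l -> l w1 (x + y) = l w1 x + l w1 y.
Proof. by move=> [_ h]; have := h w1 1 x y; rewrite scale1r mul1r. Qed.

Lemma bil01 l w2 : bilinearX l -> l 0 w2 = 0.
Proof. by move=> lb; have := @bil_sum1 l w2 nat [::] (fun=> 0) (fun=> 0) lb; rewrite !big_nil. Qed.

Lemma bil02 l w1 : bilinearX l -> l w1 0 = 0.
Proof. by move=> lb; have := @bil_sum2 l w1 nat [::] (fun=> 0) (fun=> 0) lb; rewrite !big_nil. Qed.

Lemma bilinearX_cop F G l : linear F -> linear G -> bilinearX l -> bilinearX (cop F G l).
Proof.
move=> Fl Gl [h1 h2]; split=> [w2|w1] a x y; rewrite /cop.
  by rewrite Gl !h1 mulrDr addrACA.
by rewrite Fl !h2 mulrDr addrACA.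
Qed.

(** Transposition reverses the order of composition, hence the order inside the two brackets; the
    mixed terms cancel because F and G act on different factors. *)
Lemma cop_comm F G F' G' F'' G'' l w1 w2 : bilinearX l ->
  F' (F w2) - F (F' w2) = F'' -> G' (G w1) - G (G' w1) = G'' ->
  cop F G (cop F' G' l) w1 w2 = cop F' G' (cop F G l) w1 w2 + (l w1 F'' + l G'' w2).
Proof.
move=> lb <- <-; rewrite /cop.
have -> : F' (F w2) = (F' (F w2) - F (F' w2)) + F (F' w2) by rewrite subrK.
have -> : G' (G w1) = (G' (G w1) - G (G' w1)) + G (G' w1) by rewrite subrK.
rewrite (bilD2 _ _ _ lb) (bilD1 _ _ _ lb) !subrK; ring.
Qed.

(* The action of [u (x) (t - z)^c t^n] on the dual of the tensor product; the
   variable t is local at W2, and t - z is local at W1. *)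
Definition Dop u c n : X -> X := cop (Eop (- z) c n u) (Eop z n c u).

Lemma bilinearX_Dop u c n l : bilinearX l -> bilinearX (Dop u c n l).
Proof. by apply: bilinearX_cop; apply: Eop_lin2. Qed.

Lemma LP_cop j l : bilinearX l -> LP z j l = cop (mL (- j)) (Lop z (- j)) l.
Proof.
move=> lb; apply: functional_extensionality => w1; apply: functional_extensionality => w2.
by rewrite /LP /cop /Lop (bil_sum1 _ _ _ _ lb) addrC.
Qed.

Lemma bilinearX_LP j l : bilinearX l -> bilinearX (LP z j l).
Proof. by move=> lb; rewrite LP_cop //; apply: bilinearX_cop => //; [apply: mL_lin|apply: Lop_lin]. Qed.

(** The same [a], [e] and [u'] must serve both factors, although the function is expanded at
    different points there. Only the exponent n of t is shifted; the exponent c of t - z stays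
    fixed. *)
Definition normalizes (F : W2 -> W2) (G : W1 -> W1) :=
  forall u, exists (K : nat) (a : nat -> C) (e : nat -> int) (u' : nat -> V), forall c n,
    (forall w, F (Eop (- z) c n u w) - Eop (- z) c n u (F w) =
       \sum_(i < K) a i *: Eop (- z) c (n + e i) (u' i) w) /\
    (forall w, G (Eop z n c u w) - Eop z n c u (G w) =
       \sum_(i < K) a i *: Eop z (n + e i) c (u' i) w).

Lemma normalizes_Dop v m : z != 0 -> normalizes (Eop (- z) 0 m v) (Eop z m 0 v).
Proof.
move=> z0 u; have [K hK] := vaY_trunc v u.
exists K, (binz m), (fun i => m - i%:Z), (fun i : nat => vaY v i%:Z u) => c n; split=> w.
  rewrite !Eop0 (mY_Eop_comm _ _ _ _ _ hK).
  by apply: eq_bigr => i _; rewrite addrA.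
rewrite (Eop_comm _ _ _ _ z0 hK).
by apply: eq_bigr => i _; rewrite addrA.
Qed.

Lemma normalizes_L j : z != 0 -> j \in minus1to1 -> normalizes (mL j) (Lop z j).
Proof.
move=> z0 hj u; exists (absz (j + 1)).+1, (fun k => 'C(absz (j + 1), k)%:R), Posz, 
  (fun k : nat => vaL (j - k%:Z) u) => c n; split=> w.
  by rewrite mL_Eop_comm.
by rewrite Lop_Eop_comm.
Qed.

(* Part (a) and part (b) of the compatibility condition, with the operator
   [e^{xL(1)} (-x^{-2})^{L(0)}] removed. *)
Definition mode_trunc l := forall u, exists N, forall n, n < N -> forall w1 w2, Dop u 0 n l w1 w2 = 0.
Definition mode_compat l := forall u c n w1 w2,
  Dop u c n l w1 w2 = ipow z c (fun k => Dop u 0 k l w1 w2) n.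

Section Stability.
Variables (F : W2 -> W2) (G : W1 -> W1).
Hypotheses (hFG : normalizes F G).

(** The data depend on u alone: the formula at a general c can then be compared term by term with
    the one at c = 0. *)
Lemma Dop_cop_comm u : exists (K : nat) (a : nat -> C) (e : nat -> int) (u' : nat -> V),
  forall l c n w1 w2, bilinearX l ->
  Dop u c n (cop F G l) w1 w2 =
  Dop u c n l w1 (F w2) + Dop u c n l (G w1) w2 +
  \sum_(i < K) a i * Dop (u' i) c (n + e i) l w1 w2.
Proof.
have [K [a [e [u' h]]]] := hFG u; exists K, a, e, u' => l c n w1 w2 lb.
have [hF hG] := h c n.
rewrite /Dop (cop_comm lb (hF w2) (hG w1)) (bil_sum1 _ _ _ _ lb) (bil_sum2 _ _ _ _ lb).
by rewrite -big_split; congr (_ + _); apply: eq_bigr => i _; rewrite mulrDr.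
Qed.

Lemma mode_trunc_cop l : bilinearX l -> mode_trunc l -> mode_trunc (cop F G l).
Proof.
move=> lb lt u; have [K [a [e [u' h]]]] := Dop_cop_comm u.
have [N0 h0] := lt u.
have [N hN] : exists N, forall n, n < N -> forall w1 w2,
    \sum_(i < K) a i * Dop (u' i) 0 (n + e i) l w1 w2 = 0.
  elim: K {h} => [|K [N IH]]; first by exists 0 => n _ w1 w2; rewrite big_ord0.
  have [N' h'] := lt (u' K); exists (Num.min N (N' - e K)) => k.
  rewrite lt_min => /andP [kN kN'] w1 w2; rewrite big_ord_recr /= IH // h' ?mulr0 ?addr0 //; lia.
exists (Num.min N0 N) => n; rewrite lt_min => /andP [n0 nN] w1 w2.
by rewrite h // !h0 // hN // !addr0.
Qed.

Lemma mode_compat_cop l : bilinearX l -> mode_trunc l -> mode_compat l -> mode_compat (cop F G l).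
Proof.
move=> lb lt lc u c n w1 w2; have [K [a [e [u' h]]]] := Dop_cop_comm u.
have bel v x1 x2 : exists N, below N (fun k => Dop v 0 k l x1 x2).
  by have [N hN] := lt v; exists N => k hk; apply: hN.
rewrite h // !lc; under eq_bigr do rewrite lc.
rewrite -(@ipow_sum _ _ _ _ _ (fun i k => Dop (u' i) 0 k l w1 w2)); last by move=> i; apply: bel.
have [N1 h1] := bel u w1 (F w2); have [N2 h2] := bel u (G w1) w2.
have [N3 h3] := below_sum K a e (fun i => bel (u' i) w1 w2).
rewrite -[X in X + _ + _]mul1r -(ipow_lin _ _ _ _ h1 h2).
have h12 : below (Num.min N1 N2) (fun k => 1 * Dop u 0 k l w1 (F w2) + Dop u 0 k l (G w1) w2).
  by move=> k; rewrite lt_min => /andP [k1 k2]; rewrite h1 // h2 // mulr0 addr0.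
rewrite -[X in X + _]mul1r -(ipow_lin _ _ _ _ h12 h3).
by apply: eq_ipow => k; rewrite h // !mul1r.
Qed.
End Stability.
End Dual.

(** * Inverting the opposite vertex operator map *)

Lemma fsumZ_lin (M : lmodType C) (a : C) (f g : int -> M) N N' : fsuppZ f N -> fsuppZ g N' ->
  fsumZ (fun p => a *: f p + g p) = a *: fsumZ f + fsumZ g.
Proof.
move=> hf hg.
have hf' : fsuppZ f (N + N') by move=> n hn; apply: hf; lia.
have hg' : fsuppZ g (N + N') by move=> n hn; apply: hg; lia.
rewrite (fsumZE hf') (fsumZE hg') (@fsumZE _ _ (N + N')); last first.
  by move=> n hn; rewrite hf' // hg' // scaler0 addr0.
by rewrite scaler_sumr -big_split.
Qed.

(** Evaluates the sum on a window of J consecutive integers placed anywhere, whereas [fsumZE] uses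
    one symmetric about 0. *)
Lemma fsumZ_segment (M : zmodType) (f : int -> M) (e : int) (J : nat) :
  (forall p, ~~ (0 <= p + e < J%:Z) -> f p = 0) -> fsumZ f = \sum_(j < J) f (j%:Z - e).
Proof.
move=> h; pose N := (J + absz e)%N; pose d := absz (N%:Z - e).
rewrite (@fsumZE _ _ N); last by move=> n hn; apply: h; lia.
pose r := ((N + N).+1 - (d + J))%N.
have -> : (N + N).+1 = (d + (J + r))%N by lia.
rewrite big_split_ord big_split_ord /= [X in X + _]big1 ?add0r; last first.
  by move=> i _; apply: h; have := ltn_ord i; lia.
rewrite [X in _ + X]big1 ?addr0; last by move=> i _; apply: h; lia.
by apply: eq_bigr => j _; congr f; lia.
Qed.

(** Applying L - k, with k the first eigenvalue in the list, removes one term and leaves a shorter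
    relation among the vectors (m - k) c m. *)
Lemma eigen_independent (M : lmodType C) (L : M -> M) (s : seq int) (c : int -> M) :
  linear L -> uniq s -> (forall m, L (c m) = m%:~R *: c m) ->
  \sum_(m <- s) c m = 0 -> forall m, m \in s -> c m = 0.
Proof.
move=> Ll; elim: s c => [|k s IH] c //= /andP [ks us] hc.
rewrite big_cons => h0.
have hs m : m \in s -> c m = 0.
  move=> ms.
  have /(_ us) H := IH (fun m => (m%:~R - k%:~R) *: c m).
  have : (m%:~R - k%:~R) *: c m = 0.
    apply: H ms => [j|]; first by rewrite (linZ Ll) hc !scalerA mulrC.
    have : L (c k + \sum_(j <- s) c j) - k%:~R *: (c k + \sum_(j <- s) c j) = 0.
      by rewrite h0 (lin0 Ll) scaler0 subr0.
    rewrite (linD Ll) hc scalerDr opprD addrACA subrr add0r (lin_sum _ _ _ Ll) => {2}<-.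
    rewrite scaler_sumr -sumrB; apply: eq_bigr => j _.
    by rewrite hc scalerBl.
  move/eqP; rewrite scaler_eq0 subr_eq0 eqr_int => /orP [/eqP mk|/eqP //].
  by move: ks; rewrite -mk ms.
move=> m; rewrite inE => /orP [/eqP ->|]; last exact: hs.
by move: h0; rewrite big1_seq ?addr0 // => j /andP [_]; apply: hs.
Qed.

Section Opposite.
Variables (A : zmodType) (V : SGMobiusVA A).
Implicit Types (u v : V) (m n p : int).

Lemma vaL_lin j : linear (@vaL _ V j).
Proof. by move=> a x y; apply: va_Llin. Qed.

Lemma V_ind (P : V -> Prop) : P 0 -> (forall u v, P u -> P v -> P (u + v)) ->
  (forall n a v, vaG n a v -> P v) -> forall v, P v.
Proof.
move=> P0 PD PG v; have [_ [/(_ v) [s [c [hc ->]]] _]] := va_dsum V.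
elim: s => [|i s IH]; first by rewrite big_nil.
by rewrite big_cons; apply: PD => //; apply: PG (hc i).
Qed.

(** The specification from which [epsilon] picks [wtcomp]. Existence and uniqueness make the choice
    canonical, hence linear in v. *)
Definition wt_decomp v (c : int -> V) :=
  (exists N, fsuppZ c N) /\ (forall m, vaL 0 (c m) = m%:~R *: c m) /\ v = fsumZ c.

Lemma wt_decomp_hom m v : vaL 0 v = m%:~R *: v -> wt_decomp v (fun k => if k == m then v else 0).
Proof.
move=> hv; have hs : fsuppZ (fun k => if k == m then v else 0) (absz m).
  by move=> n hn; case: eqP => // e; lia.
split; first by exists (absz m).
split=> [k|]; first by case: eqP => [->|_]; rewrite ?hv // (lin0 (vaL_lin 0)) scaler0.
rewrite (@fsumZ_segment _ _ (- m) 1) ?big_ord1 ?opprK /= ?add0r ?eqxx //.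
by move=> p; case: eqP => // ->; lia.
Qed.

Lemma wt_decomp_lin (a : C) u v c d : wt_decomp u c -> wt_decomp v d ->
  wt_decomp (a *: u + v) (fun m => a *: c m + d m).
Proof.
move=> [[N hN] [hc ->]] [[N' hN'] [hd ->]]; split; [|split].
- by exists (N + N')%N => n hn; rewrite hN ?hN' ?scaler0 ?addr0 //; lia.
- by move=> m; rewrite vaL_lin hc hd scalerDr !scalerA mulrC.
- by rewrite (fsumZ_lin _ hN hN').
Qed.

Lemma wt_decomp_exists v : exists c, wt_decomp v c.
Proof.
elim/V_ind: v => [|u v [c hc] [d hd]|n a v /va_L0 hv].
- by exists (fun k => if k == 0 then 0 else 0); apply: wt_decomp_hom; rewrite (lin0 (vaL_lin 0)) scaler0.
- by have := wt_decomp_lin 1 hc hd; rewrite scale1r; exists (fun m => 1 *: c m + d m).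
- by have := wt_decomp_hom hv; exists (fun k => if k == n then v else 0).
Qed.

Lemma wt_decomp_unique v c d : wt_decomp v c -> wt_decomp v d -> c =1 d.
Proof.
move=> hc hd m.
have [[N hN] [h1 h2]] := wt_decomp_lin (-1) hc hd.
move: h2; rewrite scaleN1r addNr (fsumZE hN) => h2.
have [mN|mN] := leP `|m| N%:Z; last first.
  by have := hN m mN; rewrite scaleN1r => /eqP; rewrite addrC subr_eq0 => /eqP.
have : -1 *: c m + d m = 0.
  apply: (eigen_independent (s := [seq i%:Z - N%:Z | i <- iota 0 (N + N).+1]) (vaL_lin 0)
    (c := fun m => -1 *: c m + d m)) => //.
  - by rewrite map_inj_uniq ?iota_uniq // => i j; lia.
  - by rewrite big_map -[X in iota 0 X]subn0 -/(index_iota _ _) big_mkord -h2.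
  - by apply/mapP; exists (absz (m + N%:Z)); rewrite ?mem_iota; lia.
by move/eqP; rewrite scaleN1r addrC subr_eq0 => /eqP.
Qed.

Lemma wtcomp_decomp v : wt_decomp v (wtcomp v).
Proof. by apply: epsilon_spec; apply: wt_decomp_exists. Qed.

Lemma wtcomp_lin m : linear (fun v => wtcomp v m).
Proof.
move=> a u v; apply: (wt_decomp_unique (wtcomp_decomp _)
  (d := fun m => a *: wtcomp u m + wtcomp v m)).
by apply: wt_decomp_lin; apply: wtcomp_decomp.
Qed.

Lemma wtcomp_hom m v k : vaL 0 v = m%:~R *: v -> wtcomp v k = if k == m then v else 0.
Proof. by move=> hv; rewrite (wt_decomp_unique (wtcomp_decomp v) (wt_decomp_hom hv)). Qed.

Lemma iterL_lin j : linear (iter j (@vaL _ V 1)).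
Proof. by elim: j => [|j IH] a x y //=; rewrite IH va_Llin. Qed.

Lemma oppvec_lin p : linear (fun v => oppvec v p).
Proof.
move=> a u v; have [[N hN] _] := wtcomp_decomp u; have [[N' hN'] _] := wtcomp_decomp v.
rewrite /oppvec -(@fsumZ_lin _ _ _ _ N N').
- apply: eq_fsumZ => m; case: ifP => _; last by rewrite scaler0 addr0.
  by rewrite wtcomp_lin iterL_lin scalerDr !scalerA [a * _]mulrC.
- by move=> n hn; rewrite hN // (lin0 (iterL_lin _)) scaler0 if_same.
- by move=> n hn; rewrite hN' // (lin0 (iterL_lin _)) scaler0 if_same.
Qed.

Lemma oppvec_hom m v p : vaL 0 v = m%:~R *: v -> oppvec v p =
  if 0 <= p + 2 * m then ((-1) ^ m / ((absz (p + 2 * m))`!)%:R) *: iter (absz (p + 2 * m)) (@vaL _ V 1) v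
  else 0.
Proof.
move=> hv; rewrite /oppvec (@fsumZ_segment _ _ (- m) 1).
  by rewrite big_ord1 opprK add0r (wtcomp_hom _ hv) eqxx.
move=> k hk; rewrite (wtcomp_hom _ hv); case: eqP => [e|_]; first by lia.
by rewrite (lin0 (iterL_lin _)) scaler0 if_same.
Qed.

Lemma iterL_weight m v j : vaL 0 v = m%:~R *: v ->
  vaL 0 (iter j (vaL 1) v) = (m - j%:Z)%:~R *: iter j (vaL 1) v.
Proof.
move=> hv; elim: j => [|j IH] /=; first by rewrite subr0.
have := @va_sl2 _ V 0 1 isT isT isT (iter j (vaL 1) v).
rewrite IH (linZ (vaL_lin 1)) => /eqP; rewrite subr_eq => /eqP ->.
by rewrite add0r -scalerDl -intrD; congr (_%:~R *: _); lia.
Qed.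

Lemma iterL_grade a v j : gspan (@vaG _ V) a v -> gspan (@vaG _ V) a (iter j (vaL 1) v).
Proof. by move=> hv; elim: j => [|j IH] //=; apply: va_LG. Qed.

(** [va_lowtrunc] concerns members of [vaG], but L(1)^j v is only known to be an L(0)-eigenvector of
    the right A-degree. Independence of eigenvectors bridges the gap. *)
Lemma low_weight_zero a : exists N : int, forall v m, gspan (@vaG _ V) a v ->
  vaL 0 v = m%:~R *: v -> m < N -> v = 0.
Proof.
have [N hN] := @va_lowtrunc _ V a; exists N => v m [s [c [hc hv]]] hm mN.
pose d n := if n == m then - v else c n *+ count_mem n s.
(* The relation is v minus its components. The list [s] may repeat a weight, so components are
   counted with multiplicity; weights below N contribute nothing, which leaves -v alone at weight
   m. *)
have := eigen_independent (s := m :: [seq n <- undup s | N <= n]) (c := d) (vaL_lin 0).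
move=> /(_ _ _ _ m); rewrite {4}/d eqxx => H; apply: oppr_inj; rewrite oppr0; apply: H.
- by rewrite /= mem_filter negb_and -ltNge mN filter_uniq ?undup_uniq.
- move=> n; rewrite /d; case: eqP => [->|_]; first by rewrite -scaleN1r (linZ (vaL_lin 0)) hm !scalerA mulrC.
  by rewrite -!scaler_nat (linZ (vaL_lin 0)) (va_L0 (hc n)) !scalerA mulrC.
- rewrite big_cons {1}/d eqxx big_filter big_mkcond /=.
  rewrite [v in - v]hv -big_undup_iterop_count /= addrC -sumrB.
  apply: big1 => n _; rewrite /d; case: leP => Nn; last first.
    by rewrite (hN n _ (c n) (hc n)) // -[iterop _ _ _ _]/(0 *+ _) mul0rn subrr.
  by case: eqP => [e|_]; [lia|rewrite -[iterop _ _ _ _]/(c n *+ _) subrr].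
- by rewrite mem_head.
Qed.

Lemma gspan_vaG n a v : vaG n a v -> gspan (@vaG _ V) a v.
Proof.
move=> hv; exists [:: n], (fun k => if k == n then v else 0).
split=> [k|]; last by rewrite big_seq1 eqxx.
by case: eqP => [->|_] //; have [/(_ (k, a)) []] := va_dsum V.
Qed.

(** L(1) lowers the weight by one and keeps the A-degree, so its powers eventually fall below the
    truncation bound for that degree. *)
Lemma L1_nilpotent n a v : vaG n a v -> exists J, iter J (vaL 1) v = 0.
Proof.
move=> hv; have [N hN] := low_weight_zero a; pose J := (absz (n - N)).+1; exists J.
apply: (hN _ (n - J%:Z)); last by lia.
  by apply: iterL_grade; apply: gspan_vaG hv.
by apply: iterL_weight; apply: va_L0 hv.
Qed.

Lemma oppvec_supp v : exists N, fsuppZ (oppvec v) N.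
Proof.
elim/V_ind: v => [|u v [N hN] [N' hN']|n a v hv].
- by exists 0%N => p _; rewrite (lin0 (oppvec_lin p)).
- by exists (N + N')%N => p hp; rewrite (linD (oppvec_lin p)) hN ?hN' ?addr0 //; lia.
- have [J hJ] := L1_nilpotent hv; exists (J + absz (2 * n)%R)%N => p hp.
  rewrite (oppvec_hom _ (va_L0 hv)); case: ifP => // hp'.
  have -> : absz (p + 2 * n)%R = (absz (p + 2 * n)%R - J + J)%N by lia.
  by rewrite iterD hJ (lin0 (iterL_lin _)) scaler0.
Qed.

(** * Transfer of properties between a family of series and its opposite series *)

Section OppSeries.
Variables (I : Type) (phi : V -> int -> I -> C).
Hypothesis phi_lin : forall (a : C) u v n i, phi (a *: u + v) n i = a * phi u n i + phi v n i.

Lemma phi0 n i : phi 0 n i = 0.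
Proof. by have := phi_lin (-1) 0 0 n i; rewrite scaler0 addr0 mulN1r addNr. Qed.

Lemma phiZ a u n i : phi (a *: u) n i = a * phi u n i.
Proof. by have := phi_lin a u 0 n i; rewrite phi0 !addr0. Qed.

(* The coefficient of x^s in phi(e^{xL(1)} (-x^{-2})^{L(0)} v, x^{-1}),
   where phi(u, t) = sum_n (phi u n) t^{-n-1}. *)
Definition oppser v s i : C := fsumZ (fun p => phi (oppvec v p) (s - p - 1) i).

Lemma oppser_supp v s i N : fsuppZ (oppvec v) N -> fsuppZ (fun p => phi (oppvec v p) (s - p - 1) i) N.
Proof. by move=> hN p hp; rewrite hN // phi0. Qed.

Lemma oppserE v s i N : fsuppZ (oppvec v) N ->
  oppser v s i = \sum_(j < (N + N).+1) phi (oppvec v (j%:Z - N%:Z)) (s - (j%:Z - N%:Z) - 1) i.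
Proof. by move=> hN; rewrite /oppser (fsumZE (oppser_supp s i hN)). Qed.

Lemma oppser_hom m v s i J : vaL 0 v = m%:~R *: v -> iter J (vaL 1) v = 0 ->
  oppser v s i = \sum_(j < J) ((-1) ^ m / (j`!)%:R) * phi (iter j (vaL 1) v) (s - j%:Z + 2 * m - 1) i.
Proof.
move=> hv hJ; rewrite /oppser (@fsumZ_segment _ _ (2 * m) J).
  apply: eq_bigr => j _; rewrite (oppvec_hom _ hv) subrK /= phiZ.
  by congr (_ * phi _ _ _); lia.
move=> p hp; rewrite (oppvec_hom _ hv); case: ifP => hp'; last by rewrite phi0.
have -> : absz (p + 2 * m)%R = (absz (p + 2 * m)%R - J + J)%N by lia.
by rewrite iterD hJ (lin0 (iterL_lin _)) scaler0 phi0.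
Qed.

Variable Q : (int -> I -> C) -> Prop.
Hypothesis Q0 : Q (fun _ _ => 0).
Hypothesis Qlin : forall (a : C) f g, Q f -> Q g -> Q (fun n i => a * f n i + g n i).
Hypothesis Qshift : forall e f, Q f -> Q (fun n i => f (n + e) i).

Lemma Q_ext f g : (forall n i, f n i = g n i) -> Q f -> Q g.
Proof.
move=> fg; suff -> : f = g by [].
by do 2 (apply: functional_extensionality => ?); apply: fg.
Qed.

Lemma Q_sum (K : nat) (a : nat -> C) (f : nat -> int -> I -> C) :
  (forall j, Q (f j)) -> Q (fun n i => \sum_(j < K) a j * f j n i).
Proof.
move=> Qf; elim: K => [|K IH]; first by apply: Q_ext Q0 => n i; rewrite big_ord0.
by apply: Q_ext (Qlin (a K) (Qf K) IH) => n i; rewrite big_ord_recr /= addrC.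
Qed.

(** Since [oppvec v] has finite support, [oppser v] is a finite sum of shifted members of the
    family. The parameter i keeps Q uniform in the vectors that the modes are applied to, as a
    truncation bound must be. *)
Lemma Q_oppser : (forall u, Q (phi u)) -> forall v, Q (oppser v).
Proof.
move=> Qphi v; have [N hN] := oppvec_supp v.
apply: (@Q_ext (fun n i => \sum_(j < (N + N).+1) 1 *
    phi (oppvec v (j%:Z - N%:Z)) (n + (- (j%:Z - N%:Z) - 1)) i)).
  by move=> n i; rewrite (oppserE _ _ hN); apply: eq_bigr => j _; rewrite mul1r addrA.
exact: (@Q_sum _ (fun=> 1) (fun j n i => phi (oppvec v (j%:Z - N%:Z)) (n + (- (j%:Z - N%:Z) - 1)) i)
  (fun j => Qshift _ (Qphi _))).
Qed.

(* On homogeneous v the j = 0 term of [oppser_hom] is, up to sign and shift,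
   phi v, and the others involve L(1)^j v, so L(1)-nilpotency inverts oppser. *)
Lemma Q_oppser_inv : (forall v, Q (oppser v)) -> forall u, Q (phi u).
Proof.
move=> Qopp u; elim/V_ind: u => [|u v hu hv|n a v hv].
- by apply: Q_ext Q0 => n i; rewrite phi0.
- by apply: Q_ext (Qlin 1 hu hv) => n i; rewrite -phi_lin scale1r.
have [J] := L1_nilpotent hv; move: (va_L0 hv) => {hv a}.
(* The induction is on the nilpotency order, with the weight generalized because L(1)^j v has weight
   n - j. *)
elim: J n v => [|J IH] m v hv hJ.
  by apply: Q_ext Q0 => n i; rewrite -[v]/(iter 0 (vaL 1) v) hJ phi0.
pose f j n i := phi (iter j.+1 (vaL 1) v) (n + (- j.+1%:Z)) i.
pose c j : C := - (-1) ^ m * ((-1) ^ m / (j.+1`!)%:R).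
have Qf j : Q (f j).
  apply: (Qshift _ (f := phi (iter j.+1 (vaL 1) v))).
  apply: (IH (m - j.+1%:Z)); first exact: iterL_weight.
  by rewrite -iterD addnS -addSn addnC iterD hJ (lin0 (iterL_lin _)).
(* The sign (-1)^m is its own inverse and the shift 1 - 2m aligns the j = 0 term with [phi v]; [c]
   and [f] cancel the terms with j > 0. *)
apply: Q_ext (Qlin ((-1) ^ m) (Qshift (- (2 * m) + 1) (Qopp v)) (Q_sum J c Qf)) => n i /=.
rewrite (oppser_hom _ _ hv hJ) big_ord_recl /= mulrDr -addrA.
have e : (-1) ^ m * (-1) ^ m = 1 :> C by rewrite -expfzMl mulrNN mulr1 exp1rz.
rewrite fact0 divr1 mulrA e mul1r.
have -> : n + (- (2 * m) + 1) - 0%:Z + 2 * m - 1 = n by lia.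
rewrite mulr_sumr -big_split big1 ?addr0 // => j _ /=.
have -> : n + (- (2 * m) + 1) - (bump 0 j)%:Z + 2 * m - 1 = n - j.+1%:Z by rewrite /bump; lia.
by rewrite /c /f /bump /=; ring.
Qed.
End OppSeries.
End Opposite.

(** * Compatibility condition *)

Section Compatibility.
Variables (A At : zmodType) (iota : A -> At) (V : SGMobiusVA A).
Variables (W1 W2 : SGGenModule iota V) (z : C).
Local Notation X := (W1 -> W2 -> C).
Implicit Types (l : X) (u v : V) (c n m : int).

Definition Dpair c l u n (w : W1 * W2) : C := Dop z u c n l w.1 w.2.

Lemma Dpair_lin c l : bilinearX l -> forall (a : C) u v n i,
  Dpair c l (a *: u + v) n i = a * Dpair c l u n i + Dpair c l v n i.
Proof.
move=> lb a u v n [w1 w2]; have [h1 h2] := lb.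
by rewrite /Dpair /Dop /cop /= !Eop_lin1 h1 h2 mulrDr addrACA.
Qed.

Lemma bil_fsumZ2 l w1 (f : int -> W2) N : bilinearX l -> fsuppZ f N ->
  l w1 (fsumZ f) = fsumZ (fun p => l w1 (f p)).
Proof.
move=> lb hf; rewrite (fsumZE hf) (@fsumZE _ _ N); last by move=> n hn; rewrite hf // bil02.
have := bil_sum2 w1 (index_enum 'I_(N + N).+1) (fun=> 1) (fun i => f (i%:Z - N%:Z)) lb.
under eq_bigr do rewrite scale1r.
by move=> ->; apply: eq_bigr => i _; rewrite mul1r.
Qed.

Lemma bil_Eop1 l w2 s c n u w1 : bilinearX l ->
  l (Eop s c n u w1) w2 = fsumN (fun k : nat => binz c k * s ^ (c - k%:Z) * l (mY u (n + k%:Z) w1) w2).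
Proof.
move=> lb; have [N hN] := mY_above (W := W1) u w1; pose K := absz (N - n + 1).
have hK : N < n + K%:Z by lia.
rewrite /Eop (spowE _ _ hN hK) (bil_sum1 _ _ _ _ lb) (@fsumNE _ _ K) // => k hk.
by rewrite hN ?bil01 ?mulr0 //; lia.
Qed.

Lemma bil_Eop2 l w1 s c n u w2 : bilinearX l ->
  l w1 (Eop s c n u w2) = fsumN (fun k : nat => binz c k * s ^ (c - k%:Z) * l w1 (mY u (n + k%:Z) w2)).
Proof.
move=> lb; have [N hN] := mY_above (W := W2) u w2; pose K := absz (N - n + 1).
have hK : N < n + K%:Z by lia.
rewrite /Eop (spowE _ _ hN hK) (bil_sum2 _ _ _ _ lb) (@fsumNE _ _ K) // => k hk.
by rewrite hN ?bil02 ?mulr0 //; lia.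
Qed.

Lemma fsumZD (f g : int -> C) N N' : fsuppZ f N -> fsuppZ g N' ->
  fsumZ f + fsumZ g = fsumZ (fun p => f p + g p).
Proof.
move=> hf hg; have := @fsumZ_lin C^o 1 f g N N' hf hg; rewrite scale1r => <-.
by apply: eq_fsumZ => p; rewrite scale1r.
Qed.

Lemma Eop_0l (W : SGGenModule iota V) s c n (w : W) : Eop s c n 0 w = 0.
Proof. exact: (lin0 (Eop_lin1 s c n w)). Qed.

(** With r = b - p - 1, upper negation turns the delta coefficients into binom(r, k) z^(r - k), that
    is, into (z + x0)^r. The case c = 0 serves the definition of Y', and c = -a - 1 the
    compatibility identity. *)
Lemma res_coef l v p c b w1 w2 : bilinearX l ->
  fsumN (fun k : nat =>
     z ^ (- (k%:Z + p - b) - 1) * binz (k%:Z + p - b) k * (-1) ^+ k *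
     l (@mY _ _ _ _ W1 (oppvec v p) (k%:Z + c) w1) w2) =
  l (Eop z (b - p - 1) c (oppvec v p) w1) w2.
Proof.
move=> lb; rewrite (bil_Eop1 _ _ _ _ _ _ lb); apply: eq_fsumN => k.
rewrite [k%:Z + c]addrC; congr (_ * _); rewrite -mulrA mulrC; congr (_ * _ ^ _); last by lia.
by rewrite -[RHS]binz_neg; congr (binz _ _ * _); lia.
Qed.

Lemma Ypcoef_oppser l v s w1 w2 : bilinearX l ->
  Ypcoef z v s l w1 w2 = oppser (Dpair 0 l) v s (w1, w2).
Proof.
move=> lb; have [N hN] := oppvec_supp v.
rewrite /Ypcoef /oppYcoef (@bil_fsumZ2 l w1 _ N) //; last first.
  by move=> p hp; rewrite hN // (lin0 (mY_lin1 _ _)).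
rewrite (@fsumZD _ _ N N).
- apply: eq_fsumZ => p; rewrite /Dpair /Dop /cop /= Eop0; congr (_ + _).
  by rewrite -res_coef //; apply: eq_fsumN => k; rewrite addr0.
- by move=> p hp; rewrite hN // (lin0 (mY_lin1 _ _)) bil02.
- by move=> p hp; apply: fsumN0 => k; rewrite hN // (lin0 (mY_lin1 _ _)) bil01 // mulr0.
Qed.

(** One bound for all p, needed to cut the sum over k uniformly before it is exchanged with the sum
    over p. *)
Lemma oppvec_mY_above (w2 : W2) v : exists N, forall p, above N (fun k => @mY _ _ _ _ W2 (oppvec v p) k w2).
Proof.
have [K hK] := oppvec_supp v.
have [N hN] : exists N, forall i : 'I_(K + K).+1, above N (fun k => @mY _ _ _ _ W2 (oppvec v (i%:Z - K%:Z)) k w2).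
  exact: (above_family _ (fun i => mY_above (oppvec v (i%:Z - K%:Z)) w2)).
exists N => p k hk; have [pK|pK] := leP `|p| K%:Z; last by rewrite hK // (lin0 (mY_lin1 _ _)).
have ip : (absz (p + K%:Z)%R < (K + K).+1)%N by lia.
have := hN (Ordinal ip) k hk; congr (mY (oppvec v _) _ _ = _).
by rewrite /=; lia.
Qed.

Hypothesis z0 : z != 0.

Lemma sign_pow c (k : nat) : (- z) ^ (c - k%:Z) = (-1) ^ c * (z ^ (c - k%:Z) * (-1) ^+ k).
Proof.
have n1 : -1 != 0 :> C by rewrite oppr_eq0 oner_eq0.
rewrite -[- z]mulN1r expfzMl [z ^ _ * _]mulrC mulrA; congr (_ * _).
rewrite expfzDr // -invr_expz; congr (_ * _).
by rewrite -exprnP invr_sign.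
Qed.

(** The coefficient of x0^a corresponds to the exponent c = -a - 1 of t - z. The first summand is
    the expansion at W1 by [res_coef], the second the expansion at W2 after exchanging the two
    sums. *)
Lemma compat_rhs_oppser l v w1 w2 (a b : int) : bilinearX l ->
  fsumZ (fun p => fsumN (fun k : nat =>
        z ^ (- (k%:Z + p - b) - 1) * binz (k%:Z + p - b) k * (-1) ^+ k *
        l (@mY _ _ _ _ W1 (oppvec v p) (k%:Z - a - 1) w1) w2))
    + (-1) ^ (a + 1) * fsumN (fun k : nat =>
        binz (- a - 1) k * z ^ (- a - 1 - k%:Z) * (-1) ^+ k * l w1 (oppYcoef v (b + k%:Z) w2)) =
  oppser (Dpair (- a - 1) l) v b (w1, w2).
Proof.
move=> lb; have [N hN] := oppvec_supp v; have [M hM] := oppvec_mY_above w2 v.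
(* From k = K on, b + k - p - 1 exceeds M for every p with absolute value at most N. *)
pose c := - a - 1; pose K := (absz (M - b + 1)%R + N + 1)%N.
have suppY k : fsuppZ (fun p => @mY _ _ _ _ W2 (oppvec v p) (b + k - p - 1) w2) N.
  by move=> p hp; rewrite hN // (lin0 (mY_lin1 _ _)).
have YE (k : nat) : l w1 (oppYcoef v (b + k%:Z) w2) =
    \sum_(i < (N + N).+1) l w1 (mY (oppvec v (i%:Z - N%:Z)) (b + k%:Z - (i%:Z - N%:Z) - 1) w2).
  rewrite /oppYcoef (bil_fsumZ2 _ lb (suppY k)) (@fsumZE _ _ N) //.
  by move=> p hp; rewrite suppY // bil02.
have tail p k : `|p| <= N%:Z -> (K <= k)%N -> @mY _ _ _ _ W2 (oppvec v p) (b + k%:Z - p - 1) w2 = 0.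
  by move=> hp hk; apply: hM; lia.
have ordN (i : 'I_(N + N).+1) : `|i%:Z - N%:Z| <= N%:Z by have := ltn_ord i; lia.
have -> : (-1) ^ (a + 1) * fsumN (fun k : nat =>
        binz c k * z ^ (c - k%:Z) * (-1) ^+ k * l w1 (oppYcoef v (b + k%:Z) w2)) =
    fsumZ (fun p => l w1 (Eop (- z) c (b - p - 1) (oppvec v p) w2)).
  rewrite (@fsumNE _ _ K); last first.
    by move=> k hk; rewrite YE big1 ?mulr0 // => i _; rewrite tail ?bil02.
  rewrite (@fsumZE _ _ N); last by move=> p hp; rewrite hN // Eop_0l bil02.
  under eq_bigr do rewrite YE mulr_sumr.
  rewrite exchange_big mulr_sumr; apply: eq_bigr => i _ /=.
  rewrite (bil_Eop2 _ _ _ _ _ _ lb) (@fsumNE _ _ K); last first.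
    move=> k hk; set p := i%:Z - N%:Z.
    have -> : b - p - 1 + k%:Z = b + k%:Z - p - 1 by lia.
    by rewrite (tail _ _ (ordN i) hk) bil02 ?mulr0.
  rewrite mulr_sumr; apply: eq_bigr => k _; rewrite sign_pow.
  have -> : (-1) ^ (a + 1) = (-1) ^ c :> C.
    have -> : c = - (a + 1) by rewrite /c; lia.
    by rewrite -exprz_inv invrN1.
  have -> : b + k%:Z - (i%:Z - N%:Z) - 1 = b - (i%:Z - N%:Z) - 1 + k%:Z by lia.
  by ring.
rewrite (@fsumZD _ _ N N).
- apply: eq_fsumZ => p; rewrite /Dpair /Dop /cop /= addrC; congr (_ + _).
  by rewrite -res_coef //; apply: eq_fsumN => k; rewrite addrA.
- by move=> p hp; apply: fsumN0 => k; rewrite hN // (lin0 (mY_lin1 _ _)) bil01 // mulr0.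
- by move=> p hp; rewrite hN // Eop_0l bil02.
Qed.

Lemma compat_a_mode l : bilinearX l -> compat_a z l <-> mode_trunc z l.
Proof.
move=> lb; have Dl := Dpair_lin 0 lb.
pose Q (f : int -> W1 * W2 -> C) := exists N, forall n, n < N -> forall i, f n i = 0.
have Q0 : Q (fun _ _ => 0) by exists 0.
have Ql (a : C) f g : Q f -> Q g -> Q (fun n i => a * f n i + g n i).
  move=> [N hN] [N' hN']; exists (Num.min N N') => n; rewrite lt_min => /andP [h h'] i.
  by rewrite hN // hN' // mulr0 addr0.
have Qs e f : Q f -> Q (fun n i => f (n + e) i).
  by move=> [N hN]; exists (N - e) => n hn i; apply: hN; lia.
split=> h.
- have H v : Q (oppser (Dpair 0 l) v).
    by have [N hN] := h v; exists N => n hn [w1 w2]; rewrite -Ypcoef_oppser // hN.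
  move=> u; have [N hN] := Q_oppser_inv Dl Q0 Ql Qs H u.
  by exists N => n hn w1 w2; apply: (hN n hn (w1, w2)).
- have H u : Q (Dpair 0 l u).
    by have [N hN] := h u; exists N => n hn [w1 w2]; apply: hN.
  move=> v; have [N hN] := Q_oppser Dl Q0 Ql Qs H v.
  by exists N => n hn w1 w2; rewrite Ypcoef_oppser // hN.
Qed.

(** [psi] is the defect of [mode_compat], and its opposite series is the defect of [compat_b], so
    the transfer applies with Q meaning vanishing. Truncation makes the expansion at infinity
    linear, as the transfer requires of [psi]. *)
Lemma compat_b_mode l : bilinearX l -> mode_trunc z l -> compat_b z l <-> mode_compat z l.
Proof.
move=> lb lt.
have bel u i : exists N, below N (fun k => Dpair 0 l u k i).
  by have [N hN] := lt u; exists N => k hk; apply: hN.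
pose psi c u n i := Dpair c l u n i - ipow z c (fun k => Dpair 0 l u k i) n.
have psil c (a : C) u v n i : psi c (a *: u + v) n i = a * psi c u n i + psi c v n i.
  have [N hN] := bel u i; have [N' hN'] := bel v i.
  rewrite /psi (@eq_ipow _ _ _ (fun k => a * Dpair 0 l u k i + Dpair 0 l v k i)); last first.
    by move=> k; apply: Dpair_lin.
  by rewrite (ipow_lin _ _ _ _ hN hN') Dpair_lin //; ring.
have E c v b i : oppser (psi c) v b i =
    oppser (Dpair c l) v b i - ipow z c (fun k => oppser (Dpair 0 l) v k i) b.
  have [N hN] := oppvec_supp v.
  rewrite (oppserE (psil c) _ _ hN) (oppserE (Dpair_lin c lb) _ _ hN).
  rewrite sumrB; congr (_ - _).
  pose e j := - (j%:Z - N%:Z) - 1 : int.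
  pose g j k := Dpair 0 l (oppvec v (j%:Z - N%:Z)) k i.
  transitivity (\sum_(j < (N + N).+1) 1 * ipow z c (g j) (b + e j)).
    by apply: eq_bigr => j _; rewrite mul1r /e addrA.
  rewrite -(@ipow_sum _ _ _ (fun=> 1) e g); last by move=> j; apply: bel.
  apply: eq_ipow => k; rewrite (oppserE (Dpair_lin 0 lb) _ _ hN).
  by apply: eq_bigr => j _; rewrite mul1r /g /e addrA.
have CB : compat_b z l <-> forall c v b i, oppser (psi c) v b i = 0.
  have L v a b w1 w2 : fsumN (fun k : nat => binz (- a - 1) k * (- z) ^+ k *
      Ypcoef z v (b - a - 1 - k%:Z) l w1 w2) =
      ipow z (- a - 1) (fun k => oppser (Dpair 0 l) v k (w1, w2)) b.
    by apply: eq_fsumN => k; rewrite Ypcoef_oppser // !addrA.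
  split=> h.
    move=> c v b [w1 w2]; rewrite E; have := h v w1 w2 (- c - 1) b.
    rewrite L compat_rhs_oppser //.
    have -> : - (- c - 1) - 1 = c by lia.
    by move=> ->; rewrite subrr.
  move=> v w1 w2 a b; rewrite L compat_rhs_oppser //; apply/esym/eqP.
  by rewrite -subr_eq0 -E h.
pose Q (f : int -> W1 * W2 -> C) := forall n i, f n i = 0.
have Q0 : Q (fun _ _ => 0) by [].
have Ql (a : C) f g : Q f -> Q g -> Q (fun n i => a * f n i + g n i).
  by move=> hf hg n i; rewrite hf hg mulr0 addr0.
have Qs e f : Q f -> Q (fun n i => f (n + e) i) by move=> hf n i; apply: hf.
rewrite CB; split=> h.
- move=> u c n w1 w2; apply/eqP; rewrite -subr_eq0; apply/eqP.
  exact: (Q_oppser_inv (psil c) Q0 Ql Qs (h c) u n (w1, w2)).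
- move=> c; apply: (Q_oppser (psil c) Q0 Ql Qs) => u n [w1 w2].
  by rewrite /psi /Dpair /= h subrr.
Qed.

Lemma COMP_mode l : COMP z l <-> bilinearX l /\ mode_trunc z l /\ mode_compat z l.
Proof.
split=> [[lb [ha hb]]|[lb [ha hb]]].
  by have lt := (compat_a_mode lb).1 ha; split=> //; split=> //; apply/(compat_b_mode lb lt).
by split=> //; split; [apply/(compat_a_mode lb)|apply/(compat_b_mode lb ha)].
Qed.

Lemma COMP_cop F G l : linear F -> linear G -> normalizes z F G ->
  COMP z l -> COMP z (cop F G l).
Proof.
move=> Fl Gl hFG /COMP_mode [lb [lt lc]]; apply/COMP_mode; split; first exact: bilinearX_cop.
by split; [apply: mode_trunc_cop|apply: mode_compat_cop].
Qed.

Lemma COMP0 : @COMP _ _ _ _ W1 W2 z (fun _ _ => 0).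
Proof.
apply/COMP_mode; split; first by split=> *; rewrite mulr0 addr0.
have D0 u c n w1 w2 : Dop z u c n (fun _ _ => 0) w1 w2 = 0 by rewrite /Dop /cop addr0.
split=> [u|u c n w1 w2]; first by exists 0.
by rewrite D0 -[LHS](ipow_zero z c n); apply: eq_ipow => k; rewrite D0.
Qed.

Lemma bilinearX_lin (a : C) l l' : bilinearX l -> bilinearX l' ->
  bilinearX (fun w1 w2 => a * l w1 w2 + l' w1 w2).
Proof.
move=> [h1 h2] [h1' h2']; split=> [w2|w1] b x y; first by rewrite h1 h1'; ring.
by rewrite h2 h2'; ring.
Qed.

Lemma COMP_lin (a : C) l l' : COMP z l -> COMP z l' -> COMP z (fun w1 w2 => a * l w1 w2 + l' w1 w2).
Proof.
move=> /COMP_mode [lb [lt lc]] /COMP_mode [lb' [lt' lc']]; apply/COMP_mode.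
split; first exact: bilinearX_lin.
have D u c n w1 w2 : Dop z u c n (fun w1 w2 => a * l w1 w2 + l' w1 w2) w1 w2 =
    a * Dop z u c n l w1 w2 + Dop z u c n l' w1 w2 by rewrite /Dop /cop; ring.
split=> [u|u c n w1 w2].
  have [N hN] := lt u; have [N' hN'] := lt' u; exists (Num.min N N') => n.
  by rewrite lt_min => /andP [h h'] w1 w2; rewrite D hN // hN' // mulr0 addr0.
have [N hN] := lt u; have [N' hN'] := lt' u; rewrite D lc lc'.
rewrite -(@ipow_lin _ _ _ _ _ N N'); [|by move=> k hk; apply: hN|by move=> k hk; apply: hN'].
by apply: eq_ipow => k; rewrite D.
Qed.

Lemma tauP_sum l v n : bilinearX l -> exists (K : nat) (u : nat -> V) (m : nat -> int),
  tauP z v n l = fun w1 w2 => \sum_(j < K) Dop z (u j) 0 (m j) l w1 w2.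
Proof.
move=> lb; have [N hN] := oppvec_supp v.
exists (N + N).+1, (fun j => oppvec v (j%:Z - N%:Z)), (fun j => - n - 1 - (j%:Z - N%:Z) - 1).
do 2 (apply: functional_extensionality => ?).
by rewrite /tauP Ypcoef_oppser // (oppserE (Dpair_lin 0 lb) _ _ hN).
Qed.

Lemma stable_tauP (P : X -> Prop) l v n : bilinearX l ->
  P (fun _ _ => 0) -> (forall l1 l2, P l1 -> P l2 -> P (fun w1 w2 => l1 w1 w2 + l2 w1 w2)) ->
  (forall u k, P (Dop z u 0 k l)) -> P (tauP z v n l).
Proof.
move=> lb P0 PD h; have [K [u [m ->]]] := tauP_sum v n lb.
elim: K => [|K IH].
  have -> : (fun w1 w2 => \sum_(j < 0) Dop z (u j) 0 (m j) l w1 w2) = (fun _ _ => 0) => //.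
  by do 2 (apply: functional_extensionality => ?); rewrite big_ord0.
have -> : (fun w1 w2 => \sum_(j < K.+1) Dop z (u j) 0 (m j) l w1 w2) =
  (fun w1 w2 => (fun w1 w2 => \sum_(j < K) Dop z (u j) 0 (m j) l w1 w2) w1 w2 +
     Dop z (u K) 0 (m K) l w1 w2).
  by do 2 (apply: functional_extensionality => ?); rewrite big_ord_recr.
by apply: PD.
Qed.

Lemma minus1to1N j : j \in minus1to1 -> - j \in minus1to1.
Proof. by rewrite !inE => /or3P [] /eqP ->. Qed.

Lemma COMP_stable : stableX z (@COMP _ _ _ _ W1 W2 z).
Proof.
move=> l hl; have lb : bilinearX l by case: hl.
split=> [v n|j hj].
  apply: stable_tauP => //; first exact: COMP0.
    move=> m m' hm hm'; have := COMP_lin 1 hm hm'; congr (COMP z _).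
    by do 2 (apply: functional_extensionality => ?); rewrite mul1r.
  by move=> u k; apply: COMP_cop hl; [apply: Eop_lin2|apply: Eop_lin2|apply: normalizes_Dop].
rewrite LP_cop //; apply: COMP_cop hl; [exact: mL_lin|exact: Lop_lin|].
exact: normalizes_L (minus1to1N hj).
Qed.
End Compatibility.

(** * Local grading restriction *)

(** Decompositions in [Dsp] run over lists that may repeat an index. Passing to multiplicities over
    a common duplicate-free list lets two of them be added. *)
Lemma sum_undup_count (I : eqType) (M : zmodType) (q r : seq I) (f : I -> M) : {subset q <= r} ->
  \sum_(n <- q) f n = \sum_(n <- undup r) f n *+ count_mem n q.
Proof.
move=> qr; rewrite -big_undup_iterop_count [RHS](bigID (mem q)) /= [X in _ + X]big1 ?addr0.
  rewrite -[RHS]big_filter; apply: perm_big; apply: uniq_perm; rewrite ?filter_uniq ?undup_uniq //.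
  move=> n; rewrite mem_undup mem_filter mem_undup /=.
  by case nq : (n \in q) => //=; rewrite qr.
by move=> n nq; rewrite (count_memPn nq).
Qed.

Section LocalGrading.
Variables (A At : zmodType) (iota : A -> At) (V : SGMobiusVA A).
Variables (W1 W2 : SGGenModule iota V) (z : C).
Local Notation X := (W1 -> W2 -> C).
Implicit Types (l : X) (u v : V) (gen : bool) (b : At).

Lemma bilinearX0 : bilinearX (fun (_ : W1) (_ : W2) => 0).
Proof. by split=> *; rewrite mulr0 addr0. Qed.

Lemma eqX l l' : (forall w1 w2, l w1 w2 = l' w1 w2) -> l = l'.
Proof. by move=> h; do 2 (apply: functional_extensionality => ?); apply: h. Qed.

Definition L0shift (n : C) l : X := fun w1 w2 => LP z 0 l w1 w2 - n * l w1 w2.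

Lemma LP_lin j (a : C) l l' : LP z j (fun w1 w2 => a * l w1 w2 + l' w1 w2) =
  fun w1 w2 => a * LP z j l w1 w2 + LP z j l' w1 w2.
Proof.
apply: eqX => w1 w2; rewrite /LP mulrDr addrACA; congr (_ + _).
by rewrite mulr_sumr -big_split; apply: eq_bigr => i _ /=; ring.
Qed.

Lemma L0shift_lin n (a : C) l l' : L0shift n (fun w1 w2 => a * l w1 w2 + l' w1 w2) =
  fun w1 w2 => a * L0shift n l w1 w2 + L0shift n l' w1 w2.
Proof. by apply: eqX => w1 w2; rewrite /L0shift LP_lin; ring. Qed.

Lemma L0shift0 n : L0shift n (fun _ _ => 0) = fun _ _ => 0.
Proof.
apply: eqX => w1 w2; rewrite /L0shift /LP mulr0 subr0 add0r big1 // => i _.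
by rewrite mulr0.
Qed.

Lemma bilinearX_L0shift n l : bilinearX l -> bilinearX (L0shift n l).
Proof.
move=> lb; have := bilinearX_lin (- n) lb (bilinearX_LP z 0 lb).
by congr bilinearX; apply: eqX => w1 w2; rewrite /L0shift addrC mulNr.
Qed.

Lemma iter_L0shift_lin n k (a : C) l l' : iter k (L0shift n) (fun w1 w2 => a * l w1 w2 + l' w1 w2) =
  fun w1 w2 => a * iter k (L0shift n) l w1 w2 + iter k (L0shift n) l' w1 w2.
Proof. by elim: k => [|k IH] //=; rewrite IH L0shift_lin. Qed.

Lemma iter_L0shift0 n k : iter k (L0shift n) (fun _ _ => 0) = fun _ _ => 0.
Proof. by elim: k => [|k IH] //=; rewrite IH L0shift0. Qed.

Lemma dualGE0 gen n b : dualGE z gen n b (fun (_ : W1) (_ : W2) => 0).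
Proof.
split; first by split; first exact: bilinearX0.
case: gen; first by exists 0%N.
by move=> w1 w2; rewrite /LP mulr0 add0r big1 // => i _; rewrite mulr0.
Qed.

Lemma dualGE_lin gen n b (a : C) l l' : dualGE z gen n b l -> dualGE z gen n b l' ->
  dualGE z gen n b (fun w1 w2 => a * l w1 w2 + l' w1 w2).
Proof.
move=> [[lb lg] le] [[lb' lg'] le']; split.
  split; first exact: bilinearX_lin.
  by move=> g1 g2 w1 w2 h h1 h2; rewrite (lg _ _ _ _ h h1 h2) (lg' _ _ _ _ h h1 h2) mulr0 addr0.
case: gen le le' => [[k hk] [k' hk']|h h' w1 w2]; last by rewrite LP_lin h h'; ring.
exists (k + k')%N => w1 w2; rewrite (iter_L0shift_lin n (k + k')).
rewrite {1}addnC !iterD.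
have -> : iter k (L0shift n) l = fun _ _ => 0 by apply: eqX => *; apply: hk.
have -> : iter k' (L0shift n) l' = fun _ _ => 0 by apply: eqX => *; apply: hk'.
by rewrite !iter_L0shift0 mulr0 addr0.
Qed.

Lemma Dsp_GE gen n b l : dualGE z gen n b l -> Dsp z gen l.
Proof.
move=> h; exists [:: (n, b)], (fun i => if i == (n, b) then l else fun _ _ => 0); split.
  by move=> i; case: eqP => [->|_] //; apply: dualGE0.
by move=> w1 w2; rewrite big_seq1 eqxx.
Qed.

Lemma Dsp0 gen : Dsp z gen (fun (_ : W1) (_ : W2) => 0).
Proof. exact: Dsp_GE (dualGE0 gen 0 0). Qed.

Lemma DspD gen l l' : Dsp z gen l -> Dsp z gen l' -> Dsp z gen (fun w1 w2 => l w1 w2 + l' w1 w2).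
Proof.
move=> [s [c [hc lE]]] [t [d [hd lE']]].
have GEZ n b (a : C) (m : X) : dualGE z gen n b m -> dualGE z gen n b (fun w1 w2 => a * m w1 w2).
  move=> h; have := dualGE_lin a h (dualGE0 gen n b); congr (dualGE z gen n b _).
  by apply: eqX => w1 w2; rewrite addr0.
exists (undup (s ++ t)), (fun i w1 w2 =>
  (count_mem i s)%:R * c i w1 w2 + (count_mem i t)%:R * d i w1 w2); split=> [i|w1 w2].
  exact: dualGE_lin (hc i) (GEZ _ _ _ _ (hd i)).
rewrite lE lE' (@sum_undup_count _ _ s (s ++ t)) => [|i is_]; last by rewrite mem_cat is_.
rewrite (@sum_undup_count _ _ t (s ++ t)) => [|i it]; last by rewrite mem_cat it orbT.
by rewrite -big_split; apply: eq_bigr => i _; rewrite !mulr_natl.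
Qed.

Lemma Dsp_ind gen (P : X -> Prop) : P (fun _ _ => 0) ->
  (forall l l', P l -> P l' -> P (fun w1 w2 => l w1 w2 + l' w1 w2)) ->
  (forall n b l, dualGE z gen n b l -> P l) -> forall l, Dsp z gen l -> P l.
Proof.
move=> P0 PD PG l [s [c [hc /eqX ->]]]; elim: s => [|i s IH].
  by have -> : (fun w1 w2 => \sum_(i <- [::]) c i w1 w2) = fun _ _ => 0 by apply: eqX => *; rewrite big_nil.
have -> : (fun w1 w2 => \sum_(j <- i :: s) c j w1 w2) =
    fun w1 w2 => c i w1 w2 + (fun w1 w2 => \sum_(j <- s) c j w1 w2) w1 w2.
  by apply: eqX => *; rewrite big_cons.
by apply: PD IH; apply: PG (hc i).
Qed.

Lemma Dsp_bilinear gen l : Dsp z gen l -> bilinearX l.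
Proof.
move: l; apply: Dsp_ind; [exact: bilinearX0| |by move=> n b l [[]]].
move=> l l' h h'; have := bilinearX_lin 1 h h'; congr bilinearX.
by apply: eqX => *; rewrite mul1r.
Qed.

(** The operator intertwines L'(0) - n with L'(0) - (n + d), hence also their iterates, so the
    exponent that kills a generalized eigenvector is preserved. *)
Lemma dualGE_cop F G (d : C) gen n b b' l : linear F -> linear G ->
  (forall w, F (mL 0 w) - mL 0 (F w) = d *: F w) ->
  (forall w, G (Lop z 0 w) - Lop z 0 (G w) = d *: G w) ->
  (forall m, dualG b m -> dualG b' (cop F G m)) ->
  dualGE z gen n b l -> dualGE z gen (n + d) b' (cop F G l).
Proof.
move=> Fl Gl hF hG hT [lg le]; split; first exact: hT.
have shift m : bilinearX m -> L0shift (n + d) (cop F G m) = cop F G (L0shift n m).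
  move=> mb; apply: eqX => w1 w2; rewrite /L0shift LP_cop; last exact: bilinearX_cop.
  rewrite oppr0 (cop_comm mb (hF w2) (hG w1)).
  have [h1 h2] := mb.
  have -> : m w1 (d *: F w2) = d * m w1 (F w2).
    by rewrite -[_ *: _]addr0 h2 (bil02 _ mb) addr0.
  have -> : m (d *: G w1) w2 = d * m (G w1) w2.
    by rewrite -[_ *: _]addr0 h1 (bil01 _ mb) addr0.
  by rewrite (LP_cop z 0 mb) oppr0 /cop; ring.
have lb := lg.1.
case: gen le => [[k hk]|h w1 w2].
  exists k => w1 w2.
  have E m : bilinearX m -> iter k (L0shift (n + d)) (cop F G m) = cop F G (iter k (L0shift n) m).
    elim: k {hk} m => [|k IH] m mb //.
    by rewrite !iterSr shift // IH //; apply: bilinearX_L0shift.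
  rewrite (_ : iter k _ _ = cop F G (iter k (L0shift n) l)); last exact: E.
  by rewrite /cop !hk addr0.
have := congr1 (fun f => f w1 w2) (shift l lb); rewrite /L0shift /cop !h subrr !subrr addr0.
by move/eqP; rewrite subr_eq0 => /eqP.
Qed.

Lemma dualG_Dop a b u k l : gspan (@vaG _ V) a u -> dualG b l -> dualG (b + iota a) (Dop z u 0 k l).
Proof.
move=> hu [lb lg]; split; first exact: bilinearX_Dop.
move=> g1 g2 w1 w2 hg h1 h2; rewrite /Dop /cop (bil_Eop1 _ _ _ _ _ _ lb) (bil_Eop2 _ _ _ _ _ _ lb).
rewrite !fsumN0 ?addr0 // => j.
  rewrite (lg (iota a + g1) g2) ?mulr0 //; last exact: m_YG.
  apply: contraNneq hg => e; rewrite opprD -e; apply/eqP.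
  by rewrite -[iota a + g1 + g2]addrA [iota a + _]addrC addrK.
rewrite (lg g1 (iota a + g2)) ?mulr0 //; last exact: m_YG.
apply: contraNneq hg => e; rewrite opprD -e; apply/eqP.
by rewrite addrCA [iota a + _]addrC addrK.
Qed.

Hypothesis z0 : z != 0.

(** The mode u_k changes weights by m - k - 1, and transposition reverses the sign. On W1 the same
    number arises from the derivative of (z + t)^k. *)
Lemma dualGE_Dop gen (m : int) a n b u k l : gspan (@vaG _ V) a u -> vaL 0 u = m%:~R *: u ->
  dualGE z gen n b l -> dualGE z gen (n + (k + 1 - m)%:~R) (b + iota a) (Dop z u 0 k l).
Proof.
move=> hu hm; apply: dualGE_cop.
- exact: Eop_lin2.
- exact: Eop_lin2.
- move=> w; rewrite -opprB mL_Eop_comm //.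
  rewrite (sum_bin0 (fun j => Eop (- z) 0 (k + j%:Z) (vaL (0 - j%:Z) u) w)) subr0 addr0 sub0r.
  rewrite hm (linZ (Eop_lin1 _ _ _ _)) !Eop0 m_Lder addrK -scalerDl -scaleNr.
  by congr (_ *: _); rewrite !intrD !intrN; ring.
- move=> w; rewrite -opprB Lop_Eop_comm //.
  rewrite (sum_bin0 (fun j => Eop z (k + j%:Z) 0 (vaL (0 - j%:Z) u) w)) subr0 addr0 sub0r.
  rewrite hm (linZ (Eop_lin1 _ _ _ _)) Eop_Lder addrK -scalerDl -scaleNr.
  by congr (_ *: _); rewrite !intrD !intrN; ring.
- by move=> l'; apply: dualG_Dop.
Qed.

Lemma dualG_L j b l : j \in minus1to1 -> dualG b l -> dualG b (LP z j l).
Proof.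
move=> hj [lb lg]; split; first exact: bilinearX_LP.
move=> g1 g2 w1 w2 hg h1 h2; rewrite /LP (lg g1 g2) ?add0r //; last first.
  by apply: m_LG => //; apply: minus1to1N.
apply: big1 => i _; rewrite (lg g1 g2) ?mulr0 //; apply: m_LG => //.
(* For i <= 1 - j the index -j - i stays within -1, 0, 1. *)
case: i => i /=; move: hj; rewrite !inE => /or3P [] /eqP -> /=.
- by case: i => [|[|[|]]].
- by case: i => [|[|]].
- by case: i => [|].
Qed.

Lemma dualGE_L gen j n b l : j \in minus1to1 -> dualGE z gen n b l -> dualGE z gen (n - j%:~R) b (LP z j l).
Proof.
move=> hj hl; have lb := hl.1.1; rewrite LP_cop //; move: hl.
have hj' := minus1to1N hj; rewrite -intrN.
apply: dualGE_cop.
- exact: mL_lin.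
- exact: Lop_lin.
- move=> w; rewrite -opprB m_sl2 ?add0r // -scaleNr.
  by congr (_ *: _); rewrite -intrN opprK.
- by move=> w; rewrite -opprB Lop_sl2 // -scaleNr opprK -intrN.
- move=> l2 hl2; rewrite -LP_cop; last by case: hl2. exact: dualG_L.
Qed.

Lemma Dsp_cop gen F G l :
  (forall n b m, dualGE z gen n b m -> Dsp z gen (cop F G m)) ->
  Dsp z gen l -> Dsp z gen (cop F G l).
Proof.
move=> h; move: l; apply: (Dsp_ind (P := fun l => Dsp z gen (cop F G l))) h.
  by have -> : cop F G (fun _ _ => 0) = fun _ _ => 0; [apply: eqX => *; rewrite /cop addr0|exact: Dsp0].
move=> l l' h h'.
have -> : cop F G (fun w1 w2 => l w1 w2 + l' w1 w2) = fun w1 w2 => cop F G l w1 w2 + cop F G l' w1 w2.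
  by apply: eqX => *; rewrite /cop addrACA.
exact: DspD.
Qed.

Lemma Dsp_Dop gen u k l : Dsp z gen l -> Dsp z gen (Dop z u 0 k l).
Proof.
move=> hl; have lb := Dsp_bilinear hl.
elim/V_ind: u => [|u v hu hv|n a u hu].
- have -> : Dop z 0 0 k l = fun _ _ => 0; last exact: Dsp0.
  by apply: eqX => *; rewrite /Dop /cop !Eop_0l (bil01 _ lb) (bil02 _ lb) addr0.
- have -> : Dop z (u + v) 0 k l = fun w1 w2 => Dop z u 0 k l w1 w2 + Dop z v 0 k l w1 w2.
    apply: eqX => w1 w2; have := Dpair_lin z 0 lb 1 u v k (w1, w2).
    by rewrite scale1r mul1r.
  exact: DspD.
- apply: Dsp_cop hl => n' b m hm; apply: Dsp_GE (dualGE_Dop k _ (va_L0 hu) hm).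
  exact: gspan_vaG hu.
Qed.

Lemma Dsp_tauP gen v n l : Dsp z gen l -> Dsp z gen (tauP z v n l).
Proof.
move=> hl; apply: stable_tauP; [exact: Dsp_bilinear hl|exact: Dsp0|exact: DspD|].
by move=> u k; apply: Dsp_Dop.
Qed.

Lemma Dsp_LP gen j l : j \in minus1to1 -> Dsp z gen l -> Dsp z gen (LP z j l).
Proof.
move=> hj hl; rewrite LP_cop; last exact: Dsp_bilinear hl.
apply: Dsp_cop hl => n b m hm; rewrite -LP_cop; last by case: hm => [[]].
exact: Dsp_GE (dualGE_L hj hm).
Qed.

(** The vector enters [admissible] only by membership, and both finiteness clauses pass to a smaller
    [Wl]. *)
Lemma LGR_transfer gen l l' : Dsp z gen l' ->
  (forall U, admissible z gen l U -> U l') -> LGR z gen l -> LGR z gen l'.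
Proof.
move=> hl' hU [lb [_ lgr]].
have sub m : Wl z gen l' m -> Wl z gen l m.
  move=> h U adm; apply: h; have Ul' := hU U adm.
  by case: adm => ? [? [? [_ ?]]]; do 3 (split=> //).
split; first exact: Dsp_bilinear hl'; split=> // n b.
have [[s hs] [K hK]] := lgr n b; split.
  by exists s => m [hm hmG]; apply: hs; split=> //; apply: sub.
by exists K => k kK m hm; apply: hK => //; apply: sub.
Qed.

Lemma LGR_stable gen : stableX z (@LGR _ _ _ _ W1 W2 z gen).
Proof.
move=> l hl; have hD : Dsp z gen l by case: hl => _ [].
split=> [v n|j hj]; apply: LGR_transfer (hl).
- exact: Dsp_tauP.
- by move=> U [_ [_ [_ [Ul [hT _]]]]]; apply: hT.
- exact: Dsp_LP.
- by move=> U [_ [_ [_ [Ul [_ hL]]]]]; apply: hL.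
Qed.
End LocalGrading.

Theorem theorem5p40 (A At : zmodType) (iota : {additive A -> At})
  (hiota : injective iota) (V : SGMobiusVA A)
  (W1 W2 : SGGenModule iota V) (z : C) (hz : z != 0) :
  @stableX _ _ _ _ W1 W2 z (@COMP _ _ _ _ W1 W2 z) /\
  @stableX _ _ _ _ W1 W2 z (@LGR _ _ _ _ W1 W2 z true) /\
  @stableX _ _ _ _ W1 W2 z (@LGR _ _ _ _ W1 W2 z false).
Proof. by split; [apply: COMP_stable|split; apply: LGR_stable]. Qed.
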